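(* There exist absolute constants $C_1$ and $C_2$ such that the following holds for all integers $2\le k\le n$. Consider the sparse graphon model with $W_0\in\mathcal W[k]$ and scaling parameter $0<\rho_n\le 1$, and put $f_0=\rho_nW_0$. (i) If $\rho_n\ge\frac{k\log k}{n}$, $n_0=\lfloor n/(2k)\rfloor$, and the step function $W_0$ is balanced, then the least squares graphon estimator $\widehat f$ constructed with this choice of $n_0$ satisfies $$\mathbb E\left[\delta^2(\widehat f,f_0)\right]\le C_1\left[\rho_n\left(\frac{k^2}{n^2}+\frac{\log k}{n}\right)+\rho_n^2\sqrt{\frac kn}\right].$$ (ii) If $\rho_n\le r$ with $r\in(0,1]$, the restricted least squares graphon estimator $\widehat f_r$ satisfies $$\mathbb E\left[\delta^2(\widehat f_r,f_0)\right]\le C_2\left[r\left(\frac{k^2}{n^2}+\frac{\log k}{n}\right)+\rho_n^2\sqrt{\frac kn}\right].$$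
   Context: A graphon is a symmetric measurable function $W:[0,1]^2\to[0,1]$. $\mathcal W[k]$ is the set of $k$-step graphons: graphons $W$ such that $W(x,y)=\boldsymbol Q_{\phi(x),\phi(y)}$ for all $x,y\in[0,1]$, for some symmetric real $k\times k$ matrix $\boldsymbol Q$ and some (measurable) $\phi:[0,1]\to\{1,\dots,k\}$. It is balanced if $\lambda(\phi^{-1}(a))=1/k$ for all $a=1,\dots,k$, with $\lambda$ the Lebesgue measure. Sparse graphon model: $\xi_1,\dots,\xi_n$ are unobserved i.i.d. uniform on $[0,1]$, $\boldsymbol\Theta_0$ is the symmetric $n\times n$ matrix with zero diagonal and $(\boldsymbol\Theta_0)_{ij}=\rho_nW_0(\xi_i,\xi_j)$ for $j<i$. Conditionally on $(\xi_i)$, the observations $\boldsymbol A'=(\boldsymbol A_{ij},1\le j<i\le n)$ are independent Bernoulli with parameters $(\boldsymbol\Theta_0)_{ij}$. $\mathbb E$ is expectation over the joint distribution. Matrix estimators: $\mathcal Z_{n,k,n_0}$ is the set of maps $z:\{1,\dots,n\}\to\{1,\dots,k\}$ all of whose fibers have at least $n_0$ elements; $\mathcal Z_{n,k}=\mathcal Z_{n,k,1}$. Let $L(\boldsymbol Q,z)=\sum_{1\le j<i\le n}(\boldsymbol A_{ij}-\boldsymbol Q_{z(i)z(j)})^2$. Least squares estimator $\widehat{\boldsymbol\Theta}$: take a minimizer $(\widehat{\boldsymbol Q},\hat z)$ of $L$ over symmetric real $k\times k$ matrices $\boldsymbol Q$ and $z\in\mathcal Z_{n,k,n_0}$, and let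 $\widehat{\boldsymbol\Theta}$ be the symmetric matrix with zero diagonal and $\widehat{\boldsymbol\Theta}_{ij}=\widehat{\boldsymbol Q}_{\hat z(i)\hat z(j)}$, $i>j$. Restricted least squares estimator $\widehat{\boldsymbol\Theta}^r$: the same with the minimum over symmetric $\boldsymbol Q$ with $\max_{a,b}|\boldsymbol Q_{ab}|\le r$ and $z\in\mathcal Z_{n,k}$. Graphon estimators: for an $n\times n$ matrix $\boldsymbol\Theta$, the empirical graphon is $\widetilde f_{\boldsymbol\Theta}(x,y)=\boldsymbol\Theta_{\lceil nx\rceil,\lceil ny\rceil}$ for $x,y\in(0,1]$; $\widehat f=\widetilde f_{\widehat{\boldsymbol\Theta}}$ and $\widehat f_r=\widetilde f_{\widehat{\boldsymbol\Theta}^r}$. Loss: $\delta^2(\check f,f_0)=\inf_\tau\iint_{(0,1)^2}|f_0(\tau(x),\tau(y))-\check f(x,y)|^2\,dx\,dy$, the infimum over all measure-preserving bijections $\tau:[0,1]\to[0,1]$. *)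

(* Defs.v *)
From HB Require Import structures.
From mathcomp Require Import all_boot all_order all_algebra.
From mathcomp Require Import all_classical all_reals all_analysis.

Set Implicit Arguments.
Unset Strict Implicit.
Unset Printing Implicit Defensive.

Import Order.TTheory GRing.Theory Num.Theory.
Import numFieldNormedType.Exports.

Local Open Scope classical_set_scope.
Local Open Scope ring_scope.

Section graphons.
Context {R : realType}.
Local Notation mu := (@lebesgue_measure R).

Definition unit_itv : set R := `[0%R, 1%R]%classic.

(* Functions on [0,1] and [0,1]^2 are represented by total functions on R and
   R x R; only their values on [0,1] and [0,1]^2 matter.  Measurability is
   Borel measurability. *)
Definition is_graphon (W : R -> R -> R) : Prop :=
  [/\ forall x y, unit_itv x -> unit_itv y -> 0 <= W x y <= 1,
      forall x y, unit_itv x -> unit_itv y -> W x y = W y x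
    & measurable_fun (unit_itv `*` unit_itv) (fun p : R * R => W p.1 p.2)].

Definition step_repr (k : nat) (W : R -> R -> R) (Q : 'M[R]_k)
    (phi : R -> 'I_k) : Prop :=
  [/\ Q^T = Q,
      forall a, measurable (unit_itv `&` phi @^-1` [set a])
    & forall x y, unit_itv x -> unit_itv y -> W x y = Q (phi x) (phi y)].

Definition step_graphon (k : nat) (W : R -> R -> R) : Prop :=
  is_graphon W /\ exists Q phi, @step_repr k W Q phi.

Definition balanced_step_graphon (k : nat) (W : R -> R -> R) : Prop :=
  is_graphon W /\ exists Q phi, @step_repr k W Q phi /\
    forall a, mu (unit_itv `&` phi @^-1` [set a]) = (k%:R^-1)%:E.

Definition measure_preserving_bijection (tau : R -> R) : Prop :=
  [/\ set_bij unit_itv unit_itv tau,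
      measurable_fun unit_itv tau
    & forall B : set R, measurable B -> B `<=` unit_itv ->
        mu (unit_itv `&` tau @^-1` B) = mu B].

Definition delta2 (f f0 : R -> R -> R) : \bar R :=
  ereal_inf
    [set (\int[mu \x mu]_(p in `]0%R, 1%R[ `*` `]0%R, 1%R[)
            (`|f0 (tau p.1) (tau p.2) - f p.1 p.2| ^+ 2)%:E)%E
    | tau in measure_preserving_bijection].

(* ceil (n x) takes values in {1, ..., n} on (0,1], whereas the elements of
   'I_n are {0, ..., n-1}; None is returned exactly outside (0,1]. *)
Definition ceil_index (n : nat) (x : R) : option 'I_n :=
  [pick i : 'I_n | Num.ceil (n%:R * x) == i.+1%:Z].

Definition empirical_graphon (n : nat) (Theta : 'M[R]_n) (x y : R) : R :=
  if (ceil_index n x, ceil_index n y) is (Some i, Some j) then Theta i j else 0.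

End graphons.

Definition edge (n : nat) := {p : 'I_n * 'I_n | (p.2 < p.1)%N}.

Definition observations (n : nat) := {ffun edge n -> bool}.

Definition sym0_mx {R : realType} (n : nat) (F : 'I_n -> 'I_n -> R) : 'M[R]_n :=
  \matrix_(i, j) if (j < i)%N then F i j else if (i < j)%N then F j i else 0.

Section estimators.
Context {R : realType} (n k : nat).

Definition labelings (n0 : nat) : set {ffun 'I_n -> 'I_k} :=
  [set z | forall a, (n0 <= #|[set i | z i == a]|)%N].

Definition ls_criterion (A : observations n)
    (Qz : 'M[R]_k * {ffun 'I_n -> 'I_k}) : R :=
  \sum_(e : edge n)
    ((A e)%:R - Qz.1 (Qz.2 (val e).1) (Qz.2 (val e).2)) ^+ 2.

Definition minimizer_on (T : Type) (D : set T) (F : T -> R) (x : T) : Prop :=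
  D x /\ forall y, D y -> F x <= F y.

Definition block_mx_of (Qz : 'M[R]_k * {ffun 'I_n -> 'I_k}) : 'M[R]_n :=
  sym0_mx (fun i j => Qz.1 (Qz.2 i) (Qz.2 j)).

Definition is_least_squares (n0 : nat) (A : observations n)
    (Theta : 'M[R]_n) : Prop :=
  exists2 Qz, minimizer_on
                [set Qz | Qz.1^T = Qz.1 /\ labelings n0 Qz.2]
                (ls_criterion A) Qz
            & Theta = block_mx_of Qz.

Definition is_restricted_least_squares (r : R) (A : observations n)
    (Theta : 'M[R]_n) : Prop :=
  exists2 Qz, minimizer_on
                [set Qz | [/\ Qz.1^T = Qz.1,
                              forall a b, `|Qz.1 a b| <= r
                            & labelings 1 Qz.2]]
                (ls_criterion A) Qz
            & Theta = block_mx_of Qz.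

End estimators.

Section model.
Context {R : realType} {d : measure_display} {Omega : measurableType d}.
Variable P : probability Omega R.

Definition mutually_independent (n : nat) (X : 'I_n -> {RV P >-> R}) : Prop :=
  forall (J : {set 'I_n}) (B : 'I_n -> set R),
    (forall i, measurable (B i)) ->
    P (\bigcap_(i in [set` J]) (X i @^-1` B i)) =
    (\prod_(i in J) P (X i @^-1` B i))%E.

(* [Y] is a version of the conditional probability P(E | G). *)
Definition is_conditional_probability (G : set (set Omega)) (E : set Omega)
    (Y : Omega -> R) : Prop :=
  (forall B : set R, measurable B -> G (Y @^-1` B)) /\
  (forall C, G C -> (\int[P]_(w in C) (Y w)%:E)%E = P (C `&` E)).

Definition observed (n : nat) (A : edge n -> {RV P >-> bool}) (w : Omega) :
  observations n := [ffun e => A e w].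

Definition connection_mx (n : nat) (rho : R) (W0 : R -> R -> R)
    (xi : 'I_n -> {RV P >-> R}) (w : Omega) : 'M[R]_n :=
  sym0_mx (fun i j => rho * W0 (xi i w) (xi j w)).

(* The [xi i] are [0,1]-valued because [W0] is a function on [0,1]^2.  The last
   condition says that the conditional law of the observations given
   sigma(xi_1, ..., xi_n) is the product of the Bernoulli laws with parameters
   the entries of [connection_mx]. *)
Definition sparse_graphon_model (n : nat) (rho : R) (W0 : R -> R -> R)
    (xi : 'I_n -> {RV P >-> R}) (A : edge n -> {RV P >-> bool}) : Prop :=
  [/\ forall i w, unit_itv (xi i w),
      forall i (B : set R), measurable B ->
        distribution P (xi i) B = uniform_prob (@ltr01 R) B,
      mutually_independent xi
    & forall a : observations n,
        is_conditional_probability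
          (g_sigma_preimage (fun i => xi i : Omega -> R))
          [set w | observed A w = a]
          (fun w => \prod_(e : edge n)
             bernoulli_pmf (connection_mx rho W0 xi w (val e).1 (val e).2)
               (a e))].

End model.

(* Main.v *)
(* On the labels l(i) of the latent positions everything is discrete: the labels
   are i.i.d. with the class masses p_a, and given the labels the observations
   are independent Bernoulli variables, so the risk is a finite sum.

   Distance to the sampled matrix.  After approximating the classes by unions of
   cells of a fine grid, an exchange of cells is a measure-preserving bijection
   that matches the class of tau(x) with the label of the cell of x outside a set
   of measure about sum_a |N_a/n - p_a|, N_a being the class counts; its
   expectation is at most sqrt(k/n).

   Estimation of the matrix.  Let T be an admissible block matrix close to the
   mean theta, obtained by moving few vertices so that all classes become large
   enough.  Minimality gives |theta - That|^2 <= |theta - T|^2 + 2 <A - theta, That - T>.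
   For fixed labels z the block values of That are rounded to a net centred at the
   block means of T; the exponential moment of a net point decays geometrically in
   its index, so the net of z contributes a factor exp(O(k^2)) and the labels a
   factor k^n.  This needs |That| <= r.  For the unrestricted estimator the block
   values are averages of A, and a union bound over pairs of vertex sets shows
   that with r of order rho this holds outside an event of probability n^(-2). *)
Require Import Defs.
From mathcomp Require Import all_boot all_order all_algebra fingroup perm.
From mathcomp Require Import all_classical all_reals all_analysis.
From mathcomp Require Import measurable_realfun ring lra zify.
Set Implicit Arguments.
Unset Strict Implicit.
Unset Printing Implicit Defensive.
Import Order.TTheory GRing.Theory Num.Theory.
Import numFieldNormedType.Exports.
Local Open Scope classical_set_scope.
Local Open Scope ring_scope.

(** * Interval exchanges of grid cells *)

(** A net of one fixed resolution would cost a logarithm of that resolution per block. This is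
    avoided by one-sided rounding: a block deviation is rounded away from zero where it correlates
    positively with the noise and to zero elsewhere, so that rounding never lowers the noise term,
    and a quadratic penalty borrowed from the loss pays for the distant net points. For the
    unrestricted estimator, sparsity and the choice of n0 make rho * n0 at least a multiple of log
    k, which beats the entropy of choosing vertex sets of size at least n0. Balance keeps the
    expected number of vertices to be moved of order k; a class of small mass would be short of n0
    vertices almost always. The restricted estimator only has to fill empty classes, so k moves
    suffice for every step graphon. When n < 4 k the classes are too small for the density argument,
    but then the rate is bounded below by a constant. *)

Lemma perm_maximal_matching (T K : finType) (f g : T -> K) :
  exists s : {perm T},
    (#|[set j | f (s j) != g j]%SET| <=
     \sum_a (#|[set j | g j == a]%SET| - #|[set j | f j == a]%SET|))%N.
Proof.
(* A permutation with the most matches works, since otherwise composing it with a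
   transposition adds a match. *)
pose m (s : {perm T}) := #|[set j | f (s j) == g j]%SET|.
have [s _ smax] := @arg_maxnP _ (1%g : {perm T}) xpredT m isT.
exists s.
rewrite -sum1_card (partition_big g xpredT)//=.
apply: leq_sum => a _.
have cf : #|[set j | f j == a]%SET| = #|[set j | f (s j) == a]%SET|.
  rewrite -[RHS](card_imset _ (@perm_inj _ s)); congr #|pred_of_set _|.
  apply/setP => j; rewrite inE; apply/idP/imsetP => [fja|[i]].
    by exists (s^-1%g j); rewrite ?inE permKV.
  by rewrite inE => ? ->.
pose A := [set j | (f (s j) != g j) && (g j == a)]%SET.
rewrite (_ : \sum_(i in _ | _) 1 = #|A|)%N; last first.
  by rewrite -sum1_card; apply: eq_bigl => j; rewrite !inE.
have [->|[j jA]] := set_0Vmem A; first by rewrite cards0.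
(* Let j be a mismatch with g j = a. If some i had f (s i) = a and g i <> a, exchanging i and j
   would repair j and lose nothing, i being a mismatch too. So the class of a under f after s lies
   inside the class under g, and the mismatches fit into the difference. *)
have sub : [set i | f (s i) == a]%SET \subset [set i | g i == a]%SET.
  apply/fintype.subsetP => i; rewrite !inE => fia; apply/negP => /negP gia.
  move: jA; rewrite inE => /andP[fj gj].
  have := smax (tperm i j * s)%g isT; apply/negP; rewrite -ltnNge.
  apply: proper_card; apply/properP; split.
    apply/fintype.subsetP => x; rewrite !inE permM.
    case: tpermP => [->|->|//]; first by rewrite (eqP fia) eq_sym (negPf gia).
    by rewrite (negPf fj).
  exists j; rewrite !inE ?permM ?tpermR (eqP gj)//.
  by rewrite -(eqP gj).
rewrite cf leq_subRL; last exact: subset_leq_card.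
rewrite -cardsUI (_ : _ :&: _ = finset.set0)%SET; last first.
  apply/setP => i; rewrite !inE; apply/negP => /andP[/eqP fi /andP[]].
  by rewrite fi => /negP + /eqP gi; rewrite gi.
rewrite cards0 addn0; apply: subset_leq_card; apply/fintype.subsetP => i.
rewrite !inE => /orP[fi|/andP[]//].
by move/fintype.subsetP/(_ i): sub; rewrite !inE; apply.
Qed.

Section cells.
Context {R : realType}.
Local Notation mu := (@lebesgue_measure R).

Lemma ceil_indexP (n : nat) (x : R) (i : 'I_n) :
  (ceil_index n x == Some i) = (i%:R < n%:R * x <= i.+1%:R).
Proof.
have E (j : 'I_n) : (Num.ceil (n%:R * x) == j.+1%:Z) = (j%:R < n%:R * x <= j.+1%:R).
  by rewrite ceil_eq (_ : j.+1%:Z - 1 = j%:Z)// -addn1 PoszD addrK.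
rewrite -E /ceil_index; case: pickP => [j /eqP ->|/(_ i)//].
by rewrite eqz_nat eqSS.
Qed.

Lemma lebesgue_measure_shift (c : R) (B : set R) : measurable B ->
  mu ((fun x => x + c) @^-1` B) = mu B.
Proof.
move=> mB.
have mf : measurable_fun setT (fun x : measurableTypeR R => x + c : measurableTypeR R).
  exact: measurable_funD.
apply/esym.
rewrite (@lebesgue_measure_unique _ (pushforward mu (fun x : measurableTypeR R => x +
    c : measurableTypeR R)))//.
move=> _ [[a b]] _ <-; rewrite /=.
transitivity (mu `]a - c, b - c]%classic).
  rewrite !lebesgue_measure_itv/= !lte_fin ltrD2r; case: ifPn => // _.
  by rewrite -!EFinB opprB addrA subrK.
congr (mu _); apply/seteqP; split => x /=; rewrite !in_itv/= ltrBlDr lerBrDr//.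
Qed.

Definition cell (n : nat) (i : 'I_n) : set R := (@ceil_index R n) @^-1` [set Some i].

Lemma cellE (n : nat) (i : 'I_n) :
  cell i = `](i%:R / n%:R), (i.+1%:R / n%:R)]%classic.
Proof.
have n0 : 0 < n%:R :> R by rewrite ltr0n (leq_ltn_trans _ (ltn_ord i)).
apply/seteqP; split => x; rewrite /cell/= in_itv/= ltr_pdivrMr// ler_pdivlMr// mulrC.
  by move/eqP; rewrite ceil_indexP.
by rewrite -ceil_indexP => /eqP.
Qed.

Lemma measurable_cell (n : nat) (i : 'I_n) : measurable (cell i).
Proof. by rewrite cellE. Qed.

Lemma lebesgue_measure_cell (n : nat) (i : 'I_n) : mu (cell i) = (n%:R^-1)%:E.
Proof.
have n0 : 0 < n%:R :> R by rewrite ltr0n (leq_ltn_trans _ (ltn_ord i)).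
rewrite cellE lebesgue_measure_itv/= lte_fin ltr_pM2r ?invr_gt0// ltr_nat ltnSn.
by rewrite -EFinB -mulrBl -natrB// subSnn mul1r.
Qed.

Lemma cell_exists (n : nat) (x : R) : (0 < n)%N -> 0 < x <= 1 ->
  exists i : 'I_n, cell i x.
Proof.
move=> n0 /andP[x0 x1]; have n0' : 0 < n%:R :> R by rewrite ltr0n.
have c0 : 0 < Num.ceil (n%:R * x) by rewrite ceil_gt0 mulr_gt0.
have cn : Num.ceil (n%:R * x) <= n%:Z by rewrite ceil_le_int -[leRHS]mulr1 ler_pM2l.
case: (Num.ceil _) c0 cn (ceil_itv (n%:R * x)) => [[//|m]|//] _ mn /andP[h1 h2].
rewrite lez_nat in mn; exists (Ordinal mn); apply/eqP; rewrite ceil_indexP/=.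
by move: h1; rewrite -addn1 PoszD addrK addn1 => ->.
Qed.

Lemma cell01 (n : nat) (i : 'I_n) (x : R) : cell i x -> 0 < x <= 1.
Proof.
have n0 : 0 < n%:R :> R by rewrite ltr0n (leq_ltn_trans _ (ltn_ord i)).
rewrite cellE/= in_itv/= => /andP[h1 h2]; apply/andP; split.
  by apply: le_lt_trans h1; rewrite divr_ge0.
by apply: (le_trans h2); rewrite ler_pdivrMr// mul1r ler_nat.
Qed.

Lemma ceil_index_refine (n m : nat) (j : 'I_(n * m)) (i : 'I_n) (x : R) :
  cell j x -> i = (j %/ m)%N :> nat -> cell i x.
Proof.
move=> + ij.
have nm0 : (0 < n * m)%N by rewrite (leq_ltn_trans _ (ltn_ord j)).
have [n0 m0] : (0 < n)%N /\ (0 < m)%N by move: nm0; rewrite muln_gt0 => /andP.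
have n0' : 0 < n%:R :> R by rewrite ltr0n.
have m0' : 0 < m%:R :> R by rewrite ltr0n.
rewrite /cell/= => /eqP; rewrite ceil_indexP => /andP[h1 h2].
have h3 : (j %/ m)%:R * m%:R <= j%:R :> R by rewrite -natrM ler_nat leq_trunc_div.
have h4 : j.+1%:R <= (j %/ m).+1%:R * m%:R :> R by rewrite -natrM ler_nat ltn_ceil.
have E : (n * m)%:R * x = n%:R * x * m%:R by rewrite natrM mulrAC.
rewrite E in h1 h2.
apply/eqP; rewrite ceil_indexP ij; apply/andP; split.
  by rewrite -(ltr_pM2r m0'); exact: le_lt_trans h1.
by rewrite -(ler_pM2r m0'); exact: le_trans h4.
Qed.

End cells.

Lemma measure_fin_partition d (T : measurableType d) (R : realType)
    (mu : {measure set T -> \bar R}) (I : finType) (f : T -> I) (A : set T) :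
  (forall i, measurable (A `&` f @^-1` [set i])) ->
  mu A = (\sum_i mu (A `&` f @^-1` [set i]))%E.
Proof.
move=> mA; have H (s : seq I) : uniq s ->
    measurable (A `&` [set x | f x \in s]) /\
    mu (A `&` [set x | f x \in s]) = (\sum_(i <- s) mu (A `&` f @^-1` [set i]))%E.
  elim: s => [_|i s IH /= /andP[si us]].
    rewrite big_nil (_ : A `&` _ = set0) ?measure0//.
    by apply/seteqP; split => x //= -[].
  have [ms es] := IH us.
  have E : A `&` [set x | f x \in i :: s] =
      (A `&` f @^-1` [set i]) `|` (A `&` [set x | f x \in s]).
    apply/seteqP; split => x /=; rewrite in_cons.
      by case=> Ax /orP[/eqP|]; [left|right].
    by case=> -[Ax] => [->|->]; rewrite ?eqxx ?orbT.
  rewrite E; split; first exact: measurableU.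
  rewrite big_cons -es; apply: measureU => //.
  apply/seteqP; split => x //= -[[_ ->] [_]].
  by rewrite (negPf si).
have [_] := H _ (index_enum_uniq I).
rewrite (_ : A `&` _ = A)//; apply/seteqP; split => x //=; first by case.
by rewrite mem_index_enum.
Qed.

Section cell_exchange.
Context {R : realType} {n : nat}.
Local Notation mu := (@lebesgue_measure R).

Lemma measurable_ceil_index (o : option 'I_n) :
  measurable (@ceil_index R n @^-1` [set o]).
Proof.
case: o => [i|]; first exact: measurable_cell.
rewrite (_ : _ @^-1` _ = ~` \big[setU/set0]_(i < n) @cell R n i).
  apply: measurableC; apply: bigsetU_measurable => i _; exact: measurable_cell.
apply/seteqP; split => x /=; rewrite -bigcup_seq/=.
  by move=> xN [i _]; rewrite /cell/= xN.
by move=> H; case E : ceil_index => [i|//]; case: H; exists i => //=; rewrite mem_index_enum.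
Qed.

(** The cells are half-open and cover (0,1]; the identity elsewhere keeps 0 fixed, which makes this
    a bijection of the closed interval. *)
Definition cell_exchange (s : {perm 'I_n}) (x : R) : R :=
  if ceil_index n x is Some i then x + ((s i)%:R - i%:R) / n%:R else x.

Lemma ceil_index_exchange (s : {perm 'I_n}) (x : R) :
  ceil_index n (cell_exchange s x) = omap s (ceil_index n x).
Proof.
rewrite /cell_exchange; case E : (ceil_index n x) => [i|]//=.
have n0 : n%:R != 0 :> R by rewrite pnatr_eq0 -lt0n (leq_ltn_trans _ (ltn_ord i)).
apply/eqP; rewrite ceil_indexP; move/eqP: E; rewrite ceil_indexP.
rewrite mulrDr mulrCA divff// mulr1 => /andP[h1 h2].
by rewrite -!natr1 in h2 *; apply/andP; split; lra.
Qed.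

Lemma cell_exchangeK (s : {perm 'I_n}) : cancel (cell_exchange s) (cell_exchange s^-1).
Proof.
move=> x; rewrite {1}/cell_exchange ceil_index_exchange /cell_exchange.
case: (ceil_index n x) => [i|]//=.
by rewrite permK -[X in _ + X / _]opprB mulNr addrK.
Qed.

Lemma cell_exchange_unit (s : {perm 'I_n}) (x : R) :
  unit_itv x -> unit_itv (cell_exchange s x).
Proof.
move=> x1; case E : (ceil_index n x) => [i|]; last by rewrite /cell_exchange E.
have /cell01/andP[h1 h2] : cell (s i) (cell_exchange s x).
  by rewrite /cell/= ceil_index_exchange E.
by rewrite /unit_itv/= in_itv/= ltW.
Qed.

Lemma measurable_cell_exchange (s : {perm 'I_n}) : measurable_fun setT (cell_exchange s).
Proof.
rewrite (_ : cell_exchange s = (fun x => x +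
    \sum_(i < n) ((s i)%:R - i%:R) / n%:R * \1_(cell i) x)).
  apply: measurable_funD => //; apply: measurable_sum => i.
  apply: measurable_funM => //; apply: measurable_indic; exact: measurable_cell.
apply/funext => x; rewrite /cell_exchange.
case E : (ceil_index n x) => [i|].
  rewrite (bigD1 i)//= big1 ?addr0 => [|j ji].
    by rewrite indicE mem_set ?mulr1// /cell/=.
  rewrite indicE memNset ?mulr0// /cell/= E => -[] ij.
  by rewrite ij eqxx in ji.
rewrite big1 ?addr0// => i _.
by rewrite indicE memNset ?mulr0// /cell/= E.
Qed.

(** Within one cell the map is a translation. Cutting B along the cells and reindexing the pieces by
    s leaves only translation invariance; the piece outside all cells is fixed pointwise. *)
Lemma cell_exchange_measure_preserving (s : {perm 'I_n}) :
  measure_preserving_bijection (cell_exchange s).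
Proof.
split.
- split.
  + by move=> x; exact: cell_exchange_unit.
  + by move=> x y _ _ xy; rewrite -(cell_exchangeK s x) xy cell_exchangeK.
  + move=> x x1; exists (cell_exchange s^-1 x); first exact: cell_exchange_unit.
    by have := cell_exchangeK s^-1%g x; rewrite invgK.
- apply: measurable_funTS. exact: measurable_cell_exchange.
move=> B mB B1; rewrite (_ : _ `&` _ = cell_exchange s @^-1` B); last first.
  apply/seteqP; split => x /=; first by case.
  move=> Bx; split => //; rewrite -(cell_exchangeK s x).
  exact/cell_exchange_unit/B1.
rewrite (@measure_fin_partition _ _ _ mu _ (@ceil_index R n) B); last first.
  by move=> o; apply: measurableI => //; exact: measurable_ceil_index.
have omap_inj : injective (omap s) by move=> [i|] [j|] //= [] /perm_inj ->.
rewrite (reindex_inj omap_inj)/=.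
rewrite (@measure_fin_partition _ _ _ mu _ (@ceil_index R n)); last first.
  move=> o; apply: measurableI; last exact: measurable_ceil_index.
  by rewrite -[X in measurable X]setTI; exact: measurable_cell_exchange.
apply: eq_bigr => -[i _|_] /=; last first.
  by congr (mu _); apply/seteqP; split => x /= [+ xN]; rewrite /cell_exchange xN.
rewrite -[RHS](@lebesgue_measure_shift _ (((s i)%:R - i%:R) / n%:R)); last first.
  apply: measurableI => //; exact: measurable_ceil_index.
have xE x : ceil_index n x = Some i -> x + ((s i)%:R - i%:R) / n%:R = cell_exchange s x.
  by rewrite /cell_exchange => ->.
congr (mu _); apply/seteqP; split => x /= [Bx xi].
  by rewrite xE// ceil_index_exchange xi.
suff xi' : ceil_index n x = Some i by rewrite -xE.
move/eqP: xi; rewrite ceil_indexP => /andP[h1 h2]; apply/eqP; rewrite ceil_indexP.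
have n0 : n%:R != 0 :> R by rewrite pnatr_eq0 -lt0n (leq_ltn_trans _ (ltn_ord i)).
move: h1 h2; rewrite mulrDr mulrCA divff// mulr1 -!natr1 => h1 h2.
by apply/andP; split; lra.
Qed.

End cell_exchange.

(* The integral of a nonnegative function is a supremum over simple functions
   below it, so monotonicity does not need measurability. *)
Lemma ge0_le_integral_any d (T : measurableType d) (R : realType)
    (mu : {measure set T -> \bar R}) (D : set T) (f g : T -> \bar R) :
  (forall x, D x -> (0 <= f x)%E) -> (forall x, D x -> (f x <= g x)%E) ->
  (\int[mu]_(x in D) f x <= \int[mu]_(x in D) g x)%E.
Proof.
move=> f0 fg; rewrite !ge0_integralE//; last first.
  by move=> x Dx; apply: le_trans (fg _ Dx); exact: f0.
apply: ge_ereal_sup => _ [h /= hf <-]; apply: ereal_sup_ubound; exists h => //= x.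
apply: (le_trans (hf x)); rewrite /patch; case: ifPn => //.
by rewrite inE => /fg.
Qed.

Lemma integral_indic_rectangles_le d1 d2 (T1 : measurableType d1)
    (T2 : measurableType d2) (R : realType)
    (m1 : {sigma_finite_measure set T1 -> \bar R})
    (m2 : {sigma_finite_measure set T2 -> \bar R})
    (I : finType) (c : I -> R) (A : I -> set T1) (B : I -> set T2)
    (D : set (T1 * T2)) :
  measurable D -> (forall t, 0 <= c t) ->
  (forall t, measurable (A t)) -> (forall t, measurable (B t)) ->
  (\int[m1 \x m2]_(p in D) (\sum_t c t * \1_(A t `*` B t) p)%:E <=
   \sum_t (c t)%:E * (m1 (A t) * m2 (B t)))%E.
Proof.
move=> mD c0 mA mB.
have mAB t : measurable (A t `*` B t) by exact: measurableX.
under eq_integral do rewrite -sumEFin.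
rewrite ge0_integral_sum//; first last.
- by move=> t x _; rewrite lee_fin mulr_ge0// indicE.
- by move=> t; apply/measurable_EFinP; apply: measurable_funM => //.
apply: lee_sum => t _.
rewrite (@integralZl_indic _ _ _ _ _ _ (fun=> A t `*` B t))//; last first.
  by move=> ct; have := c0 t; rewrite leNgt ct.
rewrite integral_indic//; apply: lee_wpmul2l; first by rewrite lee_fin.
rewrite -[leRHS]product_measure1E//; apply: le_measure; rewrite ?inE//.
exact: measurableI.
Qed.

Section grid.
Context {R : realType}.
Local Notation mu := (@lebesgue_measure R).

(** A point of [V a] has a ball that misses the other pieces, since their finite union is closed;
    compactness of [V a] makes the radius uniform. *)
Lemma compact_pieces_separated (k : nat) (V : 'I_k -> set R) :
  (forall a, compact (V a)) -> (forall a b x, V a x -> V b x -> a = b) ->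
  exists2 delta : R, 0 < delta &
    forall a b x y, V a x -> V b y -> `|x - y| < delta -> a = b.
Proof.
move=> cV dV.
have H a : \forall d \near 0^'+, V a `<=` [set x | forall b y, V b y -> `|x - y| < d -> a = b].
  have /compact_near_coveringP := cV a; apply => x Vax.
  set U := \bigcup_(b in [set b | b != a]) V b.
  have cU : closed U.
    apply: closed_bigcup => [|b _]; first exact: finite_finset.
    by apply: compact_closed => //; exact: Rhausdorff.
  have nU : (~` U) x.
    by move=> -[b /= ba Vbx]; rewrite (dV _ _ _ Vbx Vax) eqxx in ba.
  have : nbhs x (~` U).
    by apply: open_nbhs_nbhs; split => //; exact: closed_openC.
  move=> /nbhs_ballP[e /= e0 He].
  near=> x' d => /= b y Vby x'y.
  apply: contra_notP (_ : ~ ~ (~` U) y).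
    by move=> /eqP ab; apply; exists b => //=; rewrite eq_sym.
  apply; apply: He; rewrite /ball/=.
  have h1 : `|x - x'| < e / 2.
    by near: x'; apply/nbhs_ballP; exists (e / 2) => //=; rewrite divr_gt0.
  have h2 : d < e / 2 by near: d; apply: nbhs_right_lt; rewrite divr_gt0.
  rewrite (_ : x - y = (x - x') + (x' - y)); last by ring.
  by apply: (le_lt_trans (ler_normD _ _)); lra.
have : \forall d \near (0:R)^'+, forall a, V a `<=` [set x | forall b y, V b y -> `|x - y|
    < d -> a = b].
  apply: filter_forall => a; exact: H.
move=> HH; near (0:R)^'+ => d.
exists d => // a b x y Vax Vby; move: b y Vby.
apply: (near HH d) => //.
Unshelve. all: end_near. Qed.


(** Inner regularity gives a compact part of each class missing measure at most eps / k. These parts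
    are a positive distance apart, so a cell of a fine grid meets at most one of them; K is their
    union. *)
Lemma grid_approximation (k : nat) (phi : R -> 'I_k) (eps : R) :
  (forall a, measurable (unit_itv `&` phi @^-1` [set a])) -> 0 < eps ->
  exists K : set R, [/\ measurable K, K `<=` unit_itv,
    (mu (unit_itv `\` K) <= eps%:E)%E &
    exists N : nat, forall n, (N < n)%N -> exists psi : 'I_n -> 'I_k,
      forall j x, K x -> cell j x -> phi x = psi j].
Proof.
move=> mphi eps0.
have k0 : 0 < k%:R :> R by rewrite ltr0n (leq_ltn_trans _ (ltn_ord (phi 0))).
pose D a := unit_itv `&` phi @^-1` [set a].
have mu1 : mu unit_itv = 1%E by rewrite lebesgue_measure_itv/= lte_fin ltr01 -EFinB subr0.
have /choice [V HV] a : exists V : set R,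
    [/\ compact V, V `<=` D a & (mu (D a `\` V) < (eps / k%:R)%:E)%E].
  apply: lebesgue_regularity_inner; rewrite ?divr_gt0//.
    exact: mphi.
  apply: (@le_lt_trans _ _ (mu unit_itv)); last by rewrite mu1 ltry.
  by apply: le_measure; rewrite ?inE; [exact: mphi|exact: measurable_itv|exact: subIsetl].
have VD a x : V a x -> phi x = a by case: (HV a) => _ VD _ /VD[].
have [delta d0 Hd] : exists2 delta : R, 0 < delta &
    forall a b x y, V a x -> V b y -> `|x - y| < delta -> a = b.
  apply: compact_pieces_separated => [a|a b x /VD <- /VD//]; by case: (HV a).
have mV a : measurable (V a).
  apply: closed_measurable; apply: compact_closed; first exact: Rhausdorff.
  by case: (HV a).
pose K := \bigcup_(a in [set: 'I_k]) V a.
have mK : measurable K by apply: fin_bigcup_measurable => //; exact: finite_finset.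
exists K; split => //.
- by move=> x [a _]; case: (HV a) => _ + _ => /[apply] -[].
- rewrite (@measure_fin_partition _ _ _ mu _ phi); last first.
    move=> a; rewrite setIDAC setIDA; apply: measurableD => //; exact: mphi.
  rewrite (_ : eps%:E = (\sum_(a < k) (eps / k%:R)%:E)%E); last first.
    rewrite sumEFin sumr_const card_ord; congr EFin.
    by rewrite -[RHS]mulr_natr divfK// gt_eqF.
  apply: lee_sum => a _; have [_ _ /ltW] := HV a; apply: le_trans.
  apply: le_measure; rewrite ?inE.
  + by rewrite setIDAC setIDA; apply: measurableD => //; exact: mphi.
  + by apply: measurableD; [exact: (mphi a)|exact: mV].
  + move=> x [[x1 Kx] xa]; split; first by split.
    by move=> Vx; apply: Kx; exists a.
exists (Num.truncn (delta^-1)).+1 => n Nn.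
have n0 : 0 < n%:R :> R by rewrite ltr0n (leq_ltn_trans _ Nn).
have nd : n%:R^-1 < delta.
  rewrite -[ltRHS]invrK ltf_pV2 ?posrE ?invr_gt0//.
  by apply: (lt_trans (truncnS_gt _)); rewrite ltr_nat.
have /choice [psi Hpsi] : forall j : 'I_n, exists a, forall x, K x -> cell j x -> phi x = a.
  move=> j; have [[y [Ky cy]]|] := pselect (exists y, K y /\ cell j y); last first.
    by move=> no; exists (phi 0) => x Kx cx; case: no; exists x.
  exists (phi y) => x Kx cx; move: Kx Ky => [a _ Vax] [b _ Vby].
  rewrite (VD _ _ Vax) (VD _ _ Vby); apply: (Hd _ _ _ _ Vax Vby).
  move: cx cy; rewrite !cellE/= !in_itv/= -natr1 mulrDl mul1r => /andP[? ?] /andP[? ?].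
  by apply: le_lt_trans nd; rewrite ler_norml; apply/andP; split; lra.
by exists psi => j x; exact: Hpsi.
Qed.

End grid.

Lemma card_preim_divn (T : finType) (n m : nat) (l : 'I_n -> T)
    (h : forall j : 'I_(n * m), (j %/ m < n)%N) (a : T) :
  #|[set j | l (Ordinal (h j)) == a]%SET| = (#|[set i | l i == a]%SET| * m)%N.
Proof.
rewrite -!sum1_card !(big_mkcond (fun i => i \in _))/=.
case: m h => [|m] h.
  by rewrite [RHS]muln0 big1// => -[j jlt]; exfalso; move: jlt; rewrite muln0.
rewrite big_distrl/=.
have hp (p : 'I_n * 'I_m.+1) : (p.1 * m.+1 + p.2 < n * m.+1)%N.
  by case: p => i r /=; have := ltn_ord i; have := ltn_ord r; nia.
rewrite (reindex (fun p : 'I_n * 'I_m.+1 => Ordinal (hp p)))/=; last first.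
  exists (fun j : 'I_(n * m.+1) => (Ordinal (h j), Ordinal (ltn_pmod j (ltn0Sn m)))).
    move=> [i r] _ /=; congr (_, _); apply/val_inj => /=.
      by rewrite divnMDl// divn_small ?addn0.
    by rewrite modnMDl modn_small.
  by move=> j _; apply/val_inj => /=; rewrite -divn_eq.
rewrite (eq_bigr (fun p : 'I_n * 'I_m.+1 => if p.1 \in [set i | l i == a]%SET then 1 else
    0)%N); last first.
  move=> [i r] _; rewrite !inE/=; congr (if l _ == a then _ else _).
  by apply/val_inj; rewrite /= divnMDl// divn_small ?addn0.
rewrite -(pair_bigA_idem _ (fun i (r : 'I_m.+1) => if i \in [set i | l i == a]%SET then 1
    else 0)%N)//=.
by apply: eq_bigr => i _; rewrite sum_nat_const card_ord mulnC.
Qed.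

(** * Loss of an empirical graphon for given labels *)

Section delta2_bound.
Context {R : realType} (k n : nat) (phi : R -> 'I_k) (l : 'I_n -> 'I_k).
Local Notation mu := (@lebesgue_measure R).

Definition class_mass (a : 'I_k) : R := fine (mu (unit_itv `&` phi @^-1` [set a])).

Definition label_count (a : 'I_k) : nat := #|[set i | l i == a]%SET|.

Hypothesis mphi : forall a, measurable (unit_itv `&` phi @^-1` [set a]).
Hypothesis n0 : (0 < n)%N.

Lemma class_massE a : mu (unit_itv `&` phi @^-1` [set a]) = (class_mass a)%:E.
Proof.
rewrite /class_mass fineK// ge0_fin_numE//.
apply: (@le_lt_trans _ _ (mu unit_itv)).
  by apply: le_measure; rewrite ?inE; [exact: mphi|exact: measurable_itv|exact: subIsetl].
by rewrite lebesgue_measure_itv/= lte_fin ltr01 ltry.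
Qed.

Lemma measure_cells_le (N : nat) (p : pred 'I_N) :
  (mu (\bigcup_(j in [set j | p j]) @cell R N j) <= (#|p|%:R / N%:R)%:E)%E.
Proof.
rewrite (@measure_fin_partition _ _ _ mu _ (@ceil_index R N)); last first.
  move=> o; apply: measurableI; last exact: measurable_ceil_index.
  by apply: fin_bigcup_measurable => [|j _]; [exact: finite_finset|exact: measurable_cell].
rewrite (_ : (#|p|%:R / N%:R)%:E =
   (\sum_(o : option 'I_N) (if o is Some j then if p j then N%:R^-1 else 0 else 0)%:E)%E);
       last first.
  rewrite (bigD1 None)//= add0e (reindex_omap Some id)/=; last by case.
  rewrite (eq_bigl xpredT) => [|j]; last by rewrite eqxx.
  by rewrite sumEFin; congr EFin; rewrite -big_mkcond/= sumr_const mulr_natl.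
apply: lee_sum => -[j|] _; last first.
  rewrite (_ : _ `&` _ = set0) ?measure0//; apply/seteqP; split => x //= -[[j _]].
  by rewrite /cell/= => ->.
case: ifPn => pj.
  rewrite -(lebesgue_measure_cell j); apply: le_measure; rewrite ?inE.
  - apply: measurableI; last exact: measurable_ceil_index.
    by apply: fin_bigcup_measurable => [|i _]; [exact: finite_finset|exact: measurable_cell].
  - exact: measurable_cell.
  - exact: subIsetr.
rewrite (_ : _ `&` _ = set0) ?measure0//; apply/seteqP; split => x //= -[[i pi]].
by rewrite /cell/= => -> [] ij; rewrite -ij pi in pj.
Qed.

(** Classes and labels are compared on one grid of n * m cells: each of the n cells splits into m,
    and n * m exceeds the resolution required by phi. There a maximal matching applies. The
    exceptional set collects the mismatched cells and the points that tau sends outside K. *)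
Lemma exchange_matching_labels (eps : R) : 0 < eps ->
  exists tau, [/\ measure_preserving_bijection tau &
  exists B : set R, [/\ measurable B, B `<=` unit_itv,
    (mu B <= (\sum_a `|(label_count a)%:R / n%:R - class_mass a| + eps)%:E)%E &
    forall x i, unit_itv x -> ~ B x -> cell i x -> phi (tau x) = l i]].
Proof.
move=> eps0.
have k0 : 0 < k%:R :> R by rewrite ltr0n (leq_ltn_trans _ (ltn_ord (phi 0))).
(* One share is for the complement of K, the other k are for the errors of the class masses on the
   grid. *)
pose e1 := eps / (k%:R + 1).
have e10 : 0 < e1 by rewrite divr_gt0// ltr_wpDl// ltW.
have [K [mK K1 muK [N HN]]] := grid_approximation mphi e10.
pose m := N.+1; pose M := (n * m)%N.
have m0 : (0 < m)%N by [].
have [psi Hpsi] := HN M (leq_trans (ltnSn N) (leq_pmull _ n0)).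
have hdiv (j : 'I_M) : (j %/ m < n)%N by rewrite ltn_divLR// ltn_ord.
pose g (j : 'I_M) := l (Ordinal (hdiv j)).
have [s Hs] := perm_maximal_matching psi g.
pose tau := @cell_exchange R M s.
have mptau := cell_exchange_measure_preserving (R:=R) s.
exists tau; split => //.
pose mis := [pred j | psi (s j) != g j].
pose B1 := unit_itv `&` tau @^-1` (unit_itv `\` K).
pose B2 := \bigcup_(j in [set j | mis j]) @cell R M j.
have mB1 : measurable B1.
  case: mptau => _ mt _; apply: mt => //; first exact: measurable_itv.
  by apply: measurableD => //; exact: measurable_itv.
have mB2 : measurable B2.
  by apply: fin_bigcup_measurable => [|j _]; [exact: finite_finset|exact: measurable_cell].
have M0 : 0 < M%:R :> R by rewrite ltr0n muln_gt0 n0.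
have n0' : 0 < n%:R :> R by rewrite ltr0n.
have m0' : 0 < m%:R :> R by rewrite ltr0n.
exists (B1 `|` B2); split.
- exact: measurableU.
- move=> x [[]//|[j _ /cell01/andP[x0 x1]]].
  by rewrite /unit_itv/= in_itv/= x1 ltW.
- have muB1 : (mu B1 <= e1%:E)%E.
    case: mptau => _ _ mpt; rewrite mpt//.
      by apply: measurableD => //; exact: measurable_itv.
  apply: (le_trans (measureU2 mu mB1 mB2)).
  (* Class a is covered by the point 0, the cells of value a and the complement of K. The one-sided
     estimate is enough: mismatches are charged only to classes with too many labels. *)
  have mass_le a : class_mass a - #|[set j | psi j == a]%SET|%:R / M%:R <= e1.
    rewrite lerBlDl -lee_fin -class_massE EFinD.
    apply: (@le_trans _ _ (mu ([set 0] `|` (\bigcup_(j in [set j | [pred j | psi j == a]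
        j]) @cell R M j) `|` (unit_itv `\` K)))).
      apply: le_measure; rewrite ?inE.
      + exact: mphi.
      + apply: measurableU; last by apply: measurableD => //; exact: measurable_itv.
        apply: measurableU => //.
        by apply: fin_bigcup_measurable => [|j _]; [exact: finite_finset|exact:
            measurable_cell].
      + move=> x [x1 xa]; have [Kx|Kx] := pselect (K x); last by right.
        left; have [->|x0] := eqVneq x 0; first by left.
        right; have [||j cj] := @cell_exists R M x; first by rewrite muln_gt0 n0.
          by move: x1; rewrite /unit_itv/= in_itv/= => /andP[x1 ->];
              rewrite lt_neqAle eq_sym x0 x1.
        by exists j => //=; rewrite -(Hpsi _ _ Kx cj) xa.
    apply: (le_trans (measureU2 mu _ _)).
    + apply: measurableU => //.
      by apply: fin_bigcup_measurable => [|j _]; [exact: finite_finset|exact: measurable_cell].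
    + by apply: measurableD => //; exact: measurable_itv.
    apply: leeD => //; apply: (le_trans (measureU2 mu _ _)) => //.
      by apply: fin_bigcup_measurable => [|j _]; [exact: finite_finset|exact: measurable_cell].
    have z : (mu [set (0 : R)%R] <= 0)%E by rewrite le_eqVlt; apply/orP; left; apply/eqP;
        exact: lebesgue_measure_set1.
    apply: (le_trans (leeD z (measure_cells_le _))).
    rewrite add0e lee_fin ler_pM2r ?invr_gt0// ler_nat; apply: eq_leq.
    by apply: eq_card => j; rewrite !inE.
  apply: (le_trans (leeD muB1 (measure_cells_le _))); rewrite lee_fin.
  have mis_le : #|mis|%:R / M%:R <= \sum_a (`|(label_count a)%:R / n%:R - class_mass a| + e1).
    apply: (@le_trans _ _ ((\sum_a (#|[set j | g j == a]%SET| - #|[set j | psi j ==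
        a]%SET|))%N%:R / M%:R)).
      rewrite ler_pM2r ?invr_gt0// ler_nat; apply: leq_trans Hs.
      by apply/eq_leq/eq_card => j; rewrite !inE.
    rewrite natr_sum mulr_suml; apply: ler_sum => a _.
    rewrite (card_preim_divn l hdiv).
    have := mass_le a.
    set u := #|[set j | psi j == a]%SET|; rewrite -/(label_count a) => hu.
    have [le|lt] := leqP u (label_count a * m)%N; last first.
      rewrite (_ : (_ - _)%N = 0%N) ?mul0r; last by apply/eqP; rewrite subn_eq0 ltnW.
      by rewrite addr_ge0// ltW.
    rewrite natrB// mulrBl {1}/M !natrM -mulf_div divff ?gt_eqF// mulr1.
    have := ler_norm ((label_count a)%:R / n%:R - class_mass a).
    move: hu; rewrite natrM; lra.
  rewrite big_split/= sumr_const card_ord in mis_le.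
  have : e1 + e1 *+ k = eps.
    by rewrite -[e1 *+ k]mulr_natr -[X in X + _]mulr1 -mulrDr addrC divfK// gt_eqF//
        ltr_wpDl// ltW.
  move: mis_le; lra.
move=> x i x1 nB cx.
have [||j cj] := @cell_exists R M x; rewrite ?muln_gt0 ?n0//; first exact: cell01 cx.
have Kt : K (tau x).
  apply: contrapT => nK; apply: nB; left; split => //=; split => //.
  exact: cell_exchange_unit.
have cs : cell (s j) (tau x) by rewrite /cell/= ceil_index_exchange cj.
rewrite (Hpsi _ _ Kt cs).
have : ~~ mis j by apply/negP => mj; apply: nB; right; exists j.
rewrite /= negbK => /eqP ->; rewrite /g; congr l.
have : cell (Ordinal (hdiv j)) x by exact: (ceil_index_refine cj).
by rewrite /cell/= cx => -[].
Qed.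

(** Where neither coordinate lies in B the integrand is the squared error of a pair of cells.
    Elsewhere (u + v)^2 <= 2 u^2 + 2 v^2 is used with |u| <= rho; such points lie in two strips of
    measure mu B, hence 4 rho^2. *)
Lemma delta2_empirical_le (q : 'I_k -> 'I_k -> R) (rho : R) (f0 : R -> R -> R)
    (Th : 'M[R]_n) :
  (forall a b, 0 <= q a b <= rho) ->
  (forall x y, unit_itv x -> unit_itv y -> f0 x y = q (phi x) (phi y)) ->
  (delta2 (empirical_graphon Th) f0 <=
   (4 * rho ^+ 2 * \sum_a `|(label_count a)%:R / n%:R - class_mass a| +
    2 / n%:R ^+ 2 * \sum_i \sum_j (q (l i) (l j) - Th i j) ^+ 2)%:E)%E.
Proof.
move=> q01 f0q; set S1 := \sum_a `|_|; set S2 := \sum_i \sum_j _.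
apply/lee_addgt0Pr => e e0.
pose e1 := e / (4 * rho ^+ 2 + 1).
have p0 : 0 < 4 * rho ^+ 2 + 1 by have := sqr_ge0 rho; lra.
have e10 : 0 < e1 by rewrite divr_gt0.
have [tau [mptau [B [mB B1 muB HB]]]] := exchange_matching_labels e10.
apply: ereal_inf_le; eexists; first by exists tau.
pose U : set R := `]0, 1[%classic.
have mU : measurable U by exact: measurable_itv.
have Uunit x : U x -> unit_itv x.
  by rewrite /U /unit_itv/= !in_itv/= => /andP[/ltW -> /ltW ->].
pose c (t : 'I_n * 'I_n + bool) : R :=
  match t with inl p => 2 * (q (l p.1) (l p.2) - Th p.1 p.2) ^+ 2 | inr _ => 2 * rho ^+ 2 end.
pose At (t : 'I_n * 'I_n + bool) : set R :=
  match t with inl p => cell p.1 | inr b => if b then B else U end.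
pose Bt (t : 'I_n * 'I_n + bool) : set R :=
  match t with inl p => cell p.2 | inr b => if b then U else B end.
have c0 t : 0 <= c t by case: t => [p|b] /=; rewrite mulr_ge0// sqr_ge0.
have n0' : 0 < n%:R :> R by rewrite ltr0n.
apply: (@le_trans _ _ (\int[mu \x mu]_(p in U `*` U) (\sum_t c t * \1_(At t `*` Bt t) p)%:E)%E).
  apply: ge0_le_integral_any => -[x y] [/= Ux Uy]; first by rewrite lee_fin sqr_ge0.
  have tauP z : U z -> unit_itv (tau z).
    by case: mptau => -[h _ _] _ _ Uz; apply: h; exact: Uunit.
  rewrite lee_fin f0q; [|exact: tauP|exact: tauP].
  have cellP z : U z -> exists i : 'I_n, cell i z.
    rewrite /U/= in_itv/= => /andP[z0 z1]; apply: cell_exists => //.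
    by rewrite z0 ltW.
  have [[i ci] [j cj]] := (cellP x Ux, cellP y Uy).
  have -> : empirical_graphon Th x y = Th i j by rewrite /empirical_graphon ci cj.
  set z := q _ _; rewrite real_normK ?num_real//.
  rewrite big_sumType/= [X in _ <= _ + X]big_bool/=.
  have le1 : 2 * (q (l i) (l j) - Th i j) ^+ 2 <=
      \sum_(p : 'I_n * 'I_n) 2 * (q (l p.1) (l p.2) - Th p.1 p.2) ^+ 2 *
          \1_(@cell R n p.1 `*` @cell R n p.2) (x, y).
    rewrite (bigD1 (i, j))//= indicE mem_set// mulr1 lerDl; apply: sumr_ge0 => p _.
    by apply: mulr_ge0; [exact: (c0 (inl p))|rewrite indicE].
  have [Bxy|nB] := pselect (B x \/ B y); last first.
    have -> : z = q (l i) (l j).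
      rewrite /z (HB x i)// 1?(HB y j)//; try exact: Uunit.
        by move=> By; apply: nB; right.
      by move=> Bx; apply: nB; left.
    have := sqr_ge0 (q (l i) (l j) - Th i j).
    have : 0 <= 2 * rho ^+ 2 * \1_(B `*` U) (x, y) by apply: mulr_ge0;
        [exact: (c0 (inr true))|rewrite indicE].
    have : 0 <= 2 * rho ^+ 2 * \1_(U `*` B) (x, y) by apply: mulr_ge0;
        [exact: (c0 (inr true))|rewrite indicE].
    move: le1; lra.
  have le2 : 2 * rho ^+ 2 <= 2 * rho ^+ 2 * \1_(B `*` U) (x, y) +
      2 * rho ^+ 2 * \1_(U `*` B) (x, y).
    have r0 : 0 <= 2 * rho ^+ 2 by rewrite mulr_ge0// sqr_ge0.
    case: Bxy => Bz.
      by rewrite indicE mem_set// mulr1 lerDl mulr_ge0.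
    by rewrite addrC indicE mem_set// mulr1 lerDl mulr_ge0.
  have le3 : (z - q (l i) (l j)) ^+ 2 <= rho ^+ 2.
    have := q01 (phi (tau x)) (phi (tau y)); rewrite -/z.
    have /andP[h3 h4] := q01 (l i) (l j); move=> /andP[h1 h2].
    rewrite -[X in X <= _]real_normK ?num_real// ler_sqr ?nnegrE//; last by apply: le_trans h4.
    by rewrite ler_norml; apply/andP; split; lra.
  have := sqr_ge0 ((z - q (l i) (l j)) - (q (l i) (l j) - Th i j)).
  move: le1 le2 le3; set S := \sum_(p : 'I_n * 'I_n) _; move: (q (l i) (l j)) => w.
  nra.
have H := @integral_indic_rectangles_le _ _ _ _ R mu mu _ c At Bt (U `*` U).
apply: (le_trans (H _ _ _ _)) => {H} //.
- exact: measurableX.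
- by move=> -[p|[]] //=; exact: measurable_cell.
- by move=> -[p|[]] //=; exact: measurable_cell.
rewrite big_sumType/= big_bool/=.
have muU : mu U = 1%E by rewrite lebesgue_measure_itv/= lte_fin ltr01 -EFinB subr0.
have -> : (\sum_(p : 'I_n * 'I_n) (2 * (q (l p.1) (l p.2) - Th p.1 p.2) ^+ 2)%:E *
    (mu (cell p.1) * mu (cell p.2)) = (2 / n%:R ^+ 2 * S2)%:E)%E.
  rewrite /S2 pair_bigA/= mulr_sumr -sumEFin; apply: eq_bigr => p _.
  by rewrite !lebesgue_measure_cell -!EFinM -invfM -expr2 mulrAC.
rewrite muU mule1 mul1e.
have le1 : ((2 * rho ^+ 2)%:E * mu B <= (2 * rho ^+ 2 * (S1 + e1))%:E)%E.
  rewrite [leRHS]EFinM; apply: lee_wpmul2l => //.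
  by rewrite lee_fin mulr_ge0// sqr_ge0.
apply: (le_trans (leeD (lexx _) (leeD le1 le1))).
rewrite -!EFinD lee_fin.
have : (4 * rho ^+ 2) * e1 <= e.
  rewrite /e1 mulrCA ger_pMr// ler_pdivrMr// mul1r; lra.
lra.
Qed.
End delta2_bound.

(** * Least squares over block models *)

Section product_expectation.
Context {R : realType} {I T : finType}.
Implicit Types (w : I -> T -> R) (F G : {ffun I -> T} -> R).

(** Expectation of F for independent coordinates f i with mass functions w i, once these sum to
    1. *)
Definition pexp w F : R := \sum_(f : {ffun I -> T}) (\prod_i w i (f i)) * F f.

Lemma pexp_prod w (g : I -> T -> R) :
  pexp w (fun f => \prod_i g i (f i)) = \prod_i \sum_t w i t * g i t.
Proof. by rewrite bigA_distr_bigA; apply: eq_bigr => f _; rewrite big_split. Qed.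

Lemma pexpD w F G : pexp w (fun f => F f + G f) = pexp w F + pexp w G.
Proof. by rewrite -big_split; apply: eq_bigr => f _; rewrite mulrDr. Qed.

Lemma pexpZ w c F : pexp w (fun f => c * F f) = c * pexp w F.
Proof. by rewrite mulr_sumr; apply: eq_bigr => f _; rewrite mulrCA. Qed.

Lemma pexp_sum (J : finType) (P : pred J) w (F : J -> {ffun I -> T} -> R) :
  pexp w (fun f => \sum_(j | P j) F j f) = \sum_(j | P j) pexp w (F j).
Proof. by rewrite exchange_big; apply: eq_bigr => f _; rewrite mulr_sumr. Qed.

Lemma pexp_cst w c : (forall i, \sum_t w i t = 1) -> pexp w (fun=> c) = c.
Proof.
move=> w1; rewrite -[RHS]mulr1 /pexp -mulr_suml mulrC; congr (_ * _).
by rewrite -bigA_distr_bigA big1.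
Qed.

Lemma pexp_le w F G : (forall i t, 0 <= w i t) -> (forall f, F f <= G f) ->
  pexp w F <= pexp w G.
Proof.
by move=> w0 FG; apply: ler_sum => f _; rewrite ler_wpM2l// prodr_ge0.
Qed.

Lemma eq_pexp w F G : F =1 G -> pexp w F = pexp w G.
Proof. by move=> FG; apply: eq_bigr => f _; rewrite FG. Qed.

End product_expectation.

Section bernoulli.
Context {R : realType} {E : finType} (theta : E -> R).
Hypothesis theta01 : forall e, 0 <= theta e <= 1.

Definition bern (e : E) (b : bool) : R := bernoulli_pmf (theta e) b.

Lemma bern_ge0 e b : 0 <= bern e b.
Proof. exact: bernoulli_pmf_ge0. Qed.

Lemma sum_bern e : \sum_b bern e b = 1.
Proof. by rewrite big_bool/= /bern /bernoulli_pmf addrC subrK. Qed.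

(** Inverting 1 - u <= exp (- u) leaves the polynomial inequality 0 <= u^2 (1 - 2 u), which holds up
    to u = 1/2. *)
Lemma expR_le_quadratic (u : R) : `|u| <= 2^-1 -> expR u <= 1 + u + 2 * u ^+ 2.
Proof.
rewrite ler_norml => /andP[h1 h2].
have h3 := expR_ge1Dx (- u); have h4 := expR_gt0 u.
have h5 : expR (- u) * expR u = 1 by rewrite -expRD addNr expR0.
have h6 : (1 - u) * expR u <= 1 by rewrite -[leRHS]h5 ler_wpM2r// ltW.
have h7 : 1 <= (1 - u) * (1 + u + 2 * u ^+ 2) by have := sqr_ge0 u; nra.
have h8 : 0 < 1 - u by lra.
by rewrite -(ler_pM2l h8); exact: le_trans h6 h7.
Qed.

(** The exponent keeps the factor theta e, a Bernoulli variance being at most its mean. This brings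
    the scale r, rather than 1, into the rate. *)
Lemma bern_mgf_le (u : E -> R) : (forall e, `|u e| <= 2^-1) ->
  pexp bern (fun a => expR (\sum_e u e * ((a e)%:R - theta e))) <=
  expR (2 * \sum_e theta e * u e ^+ 2).
Proof.
move=> u1; rewrite (eq_pexp _ (G := fun a => \prod_e expR (u e * ((a e : bool)%:R - theta e)))).
  rewrite (pexp_prod _ (fun e b => expR (u e * ((b : bool)%:R - theta e)))).
  rewrite mulr_sumr expR_sum; apply: ler_prod => e _; apply/andP; split.
    by apply: sumr_ge0 => b _; rewrite mulr_ge0 ?bern_ge0 ?expR_ge0.
  rewrite big_bool/= /bern /bernoulli_pmf.
  have -> : u e * (1 - theta e) = - (u e * theta e) + u e by ring.
  rewrite sub0r mulrN expRD.
  have /andP[t0 t1] := theta01 e.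
  have h1 := expR_le_quadratic (u1 e).
  have h2 := expR_ge1Dx (theta e * (expR (u e) - 1)).
  rewrite (_ : _ + _ = expR (- (u e * theta e)) * (1 + theta e * (expR (u e) - 1)));
      last by ring.
  apply: (@le_trans _ _ (expR (- (u e * theta e)) * expR (theta e * (expR (u e) - 1)))).
    by rewrite ler_wpM2l ?expR_ge0.
  rewrite -expRD ler_expR; nra.
by move=> a; rewrite expR_sum.
Qed.

(** Since exp (1/2) <= 2, each factor is at most 1 + theta e, hence at most exp (theta e). *)
Lemma bern_half_exp_le (D : {set E}) :
  pexp bern (fun a => expR (2^-1 * \sum_(e in D) (a e)%:R)) <=
  expR (\sum_(e in D) theta e).
Proof.
rewrite (eq_pexp _ (G := fun a => \prod_e expR ((if e \in D then 2^-1 else 0) *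
    (a e : bool)%:R))).
  rewrite (pexp_prod _ (fun e b => expR ((if e \in D then 2^-1 else 0) * (b : bool)%:R))).
  rewrite (big_mkcond (fun e => e \in D))/= expR_sum; apply: ler_prod => e _; apply/andP; split.
    by apply: sumr_ge0 => b _; rewrite mulr_ge0 ?bern_ge0 ?expR_ge0.
  rewrite big_bool/= /bern /bernoulli_pmf mulr0 expR0 !mulr1.
  have /andP[t0 t1] := theta01 e.
  case: ifP => _; last by rewrite expR0; lra.
  have h1 : expR (2^-1 : R) <= 1 + 2^-1 + 2 * 2^-1 ^+ 2.
    by apply: expR_le_quadratic; rewrite ger0_norm.
  have h2 := expR_ge1Dx (theta e).
  nra.
move=> a; rewrite -expR_sum; congr expR.
by rewrite mulr_sumr big_mkcond/=; apply: eq_bigr => e _; case: ifP => _; rewrite ?mul0r.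
Qed.

End bernoulli.

(** * Least squares over a finite family of partitions *)

Section least_squares_risk.
Context {R : realType} {E Z B : finType}.
Variables (theta T : E -> R) (blk : Z -> E -> B) (rho r : R).
Hypothesis theta01 : forall e, 0 <= theta e <= 1.
Hypothesis theta_rho : forall e, theta e <= rho.
Hypothesis T_rho : forall e, 0 <= T e <= rho.
Hypothesis rho_r : rho <= r.
Hypothesis r0 : 0 < r.

Local Notation noise a := (fun e => ((a : {ffun E -> bool}) e)%:R - theta e).

Definition block_size (z : Z) (b : B) : R := \sum_(e | blk z e == b) 1.

Definition block_mean (z : Z) (b : B) : R :=
  (\sum_(e | blk z e == b) T e) / block_size z b.

Lemma block_size_ge0 z b : 0 <= block_size z b.
Proof. exact: sumr_ge0. Qed.

Lemma block_size_ge1 z e : 1 <= block_size z (blk z e).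
Proof. by rewrite /block_size (bigD1 e)//= lerDl sumr_ge0. Qed.

Lemma sum_block (z : Z) (f : E -> R) (g : B -> R) :
  \sum_e g (blk z e) * f e = \sum_b g b * \sum_(e | blk z e == b) f e.
Proof.
rewrite (partition_big (blk z) xpredT)//=; apply: eq_bigr => b _.
by rewrite mulr_sumr; apply: eq_bigr => e /eqP ->.
Qed.

Lemma block_mean_bounds z e : 0 <= block_mean z (blk z e) <= rho.
Proof.
have s0 : 0 < block_size z (blk z e) by apply: lt_le_trans (block_size_ge1 z e).
rewrite /block_mean; apply/andP; split.
  rewrite divr_ge0 ?block_size_ge0//; apply: sumr_ge0 => e' _.
  by case/andP: (T_rho e').
rewrite ler_pdivrMr// /block_size mulr_sumr; apply: ler_sum => e' _.
by rewrite mulr1; case/andP: (T_rho e').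
Qed.

Lemma block_center z b : \sum_(e | blk z e == b) (block_mean z b - T e) = 0.
Proof.
have [e /eqP eb|none] := pickP (fun e => blk z e == b); last by rewrite big_pred0.
have s0 : block_size z b != 0 by rewrite -eb gt_eqF// (lt_le_trans _ (block_size_ge1 z e)).
rewrite sumrB (eq_bigr (fun=> block_mean z b * 1)) => [|e' _]; last by rewrite mulr1.
by rewrite -mulr_sumr -/(block_size z b) /block_mean divfK// subrr.
Qed.

(** Deviations constant on blocks are orthogonal to the residual of T, so the misfit between T and
    the partition is a separate summand and only d has to be discretised. *)
Lemma block_pythagoras (z : Z) (d : B -> R) :
  \sum_e (d (blk z e) + block_mean z (blk z e) - T e) ^+ 2 =
  \sum_b block_size z b * d b ^+ 2 + \sum_e (block_mean z (blk z e) - T e) ^+ 2.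
Proof.
have cross : \sum_e d (blk z e) * (block_mean z (blk z e) - T e) = 0.
  rewrite (partition_big (blk z) xpredT)//= big1// => b _.
  rewrite (eq_bigr (fun e => d b * (block_mean z b - T e))) => [|e /eqP -> //].
  by rewrite -mulr_sumr block_center mulr0.
transitivity (\sum_e (d (blk z e) ^+ 2 * 1 +
    ((block_mean z (blk z e) - T e) ^+ 2 +
     2 * (d (blk z e) * (block_mean z (blk z e) - T e))))).
  by apply: eq_bigr => e _; ring.
rewrite big_split/= big_split/= -mulr_sumr cross mulr0 addr0.
rewrite (sum_block z (fun=> 1) (fun b => d b ^+ 2)); congr (_ + _).
by apply: eq_bigr => b _; rewrite mulrC.
Qed.

(* With [c = 1/64], the exponential moments below use [lambda = c / r], and the
   net has spacing [h] with [block_size * h^2 = r / (2 c^2)], which makes the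
   weight of the [j]-th net point of a block at most [exp (- (j - 1)^2)].  The net
   is centred at the block means of [T], which need not be constant on the blocks;
   [valid] discards the indices made redundant by the truncation in [amp]. *)
Let lambda : R := (64 * r)^-1.
Let eta2 : R := 32 * (64 * r).
Let h (z : Z) (b : B) : R := Num.sqrt (eta2 / block_size z b).

(** Enough indices: |t| <= 2 r and block_size <= |E| bound (|t| / h)^2 by the truncated quantity,
    and a natural number is at most its square. *)
Let J : nat := (Num.truncn (4 * r ^+ 2 * #|E|%:R / eta2)).+3.

Let net := (Z * {ffun B -> bool * 'I_J})%type.

(** The cap is harmless, as the deviations to be rounded are at most 2 r; it keeps net points below
    3 r, so that [lambda * pt] stays in the range of the moment bound. *)
Let amp (z : Z) (b : B) (j : nat) : R := Num.min (2 * r) (j%:R * h z b).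

Let dev (nu : net) (b : B) : R :=
  (-1) ^+ (nu.2 b).1 * amp nu.1 b (nu.2 b).2.

Let pt (nu : net) (e : E) : R :=
  dev nu (blk nu.1 e) + block_mean nu.1 (blk nu.1 e) - T e.

Let valid (nu : net) : bool :=
  [forall b, eta2 * ((nu.2 b).2.-1%:R ^+ 2) <=
             block_size nu.1 b * dev nu b ^+ 2].

(** The penalty is twice the exponent that the moment bound produces, so a factor exp (- lambda / 32
    * |pt|^2) survives. *)
Let Y (nu : net) (a : {ffun E -> bool}) : R :=
  lambda * (\sum_e pt nu e * noise a e) - lambda / 16 * \sum_e pt nu e ^+ 2.

Let lambda_gt0 : 0 < lambda. Proof. by rewrite invr_gt0 mulr_gt0. Qed.
Let eta2_gt0 : 0 < eta2. Proof. by do 2 ![rewrite mulr_gt0 ?ltr0n//]. Qed.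
Let h_ge0 z b : 0 <= h z b. Proof. exact: sqrtr_ge0. Qed.
Let amp_ge0 z b j : 0 <= amp z b j.
Proof. by rewrite /amp le_min !mulr_ge0// ltW. Qed.

Let norm_dev nu b : `|dev nu b| = amp nu.1 b (nu.2 b).2.
Proof. by rewrite /dev normrM normrX normrN1 expr1n mul1r ger0_norm. Qed.

Let norm_dev_le nu b : `|dev nu b| <= 2 * r.
Proof. by rewrite norm_dev /amp ge_min lexx. Qed.

Let norm_pt nu e : `|pt nu e| <= 3 * r.
Proof.
have := norm_dev_le nu (blk nu.1 e); have := block_mean_bounds nu.1 e.
have /andP[h1 h2] := T_rho e => /andP[h3 h4].
rewrite !ler_norml /pt => /andP[h5 h6]; apply/andP; split; move: rho_r; lra.
Qed.

Let exp_weight (j : nat) : expR (- (j.-1%:R ^+ 2)) <= 2 / 2 ^+ j :> R.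
Proof.
case: j => [|j] /=; first by rewrite expr0n/= oppr0 expR0 expr0 divr1; lra.
rewrite (exprS 2 j) invfM mulVKf// expRN lef_pV2 ?posrE ?expR_gt0 ?exprn_gt0//.
apply: (@le_trans _ _ (expR j%:R)).
  rewrite -[j%:R]mulr1 expRM_natl; apply: lerXn2r; rewrite ?nnegrE ?expR_ge0//.
  by have := expR_ge1Dx (1 : R).
by rewrite ler_expR -natrX ler_nat; case: j => // j; rewrite leq_pmulr.
Qed.

(** By [valid], |pt|^2 is at least eta2 times the sum of the (j - 1)^2, and lambda / 32 * eta2 =
    1. *)
Lemma net_moment (nu : net) : valid nu ->
  pexp (bern theta) (fun a => expR (Y nu a)) <=
  \prod_b (2 / 2 ^+ (nu.2 b).2).
Proof.
move=> /forallP nuV.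
set S := \sum_e pt nu e ^+ 2.
have E1 : pexp (bern theta) (fun a => expR (Y nu a)) =
    expR (- (lambda / 16 * S)) *
    pexp (bern theta) (fun a => expR (\sum_e (lambda * pt nu e) * noise a e)).
  rewrite -pexpZ; apply: eq_pexp => a; rewrite -expRD addrC; congr (expR (_ - _)).
  by rewrite mulr_sumr; apply: eq_bigr => e _; rewrite mulrA.
rewrite E1; apply: (@le_trans _ _ (expR (- (lambda / 16 * S)) *
    expR (2 * \sum_e theta e * (lambda * pt nu e) ^+ 2))).
  rewrite ler_wpM2l ?expR_ge0//; apply: bern_mgf_le => // e.
  rewrite normrM gtr0_norm// /lambda invfM -mulrA (le_trans (_ : _ <= 64^-1 * 3))//;
      last by lra.
  by rewrite ler_pM2l// mulrC ler_pdivrMr.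
rewrite -expRD.
have le1 : \sum_e theta e * (lambda * pt nu e) ^+ 2 <= lambda / 64 * S.
  rewrite mulr_sumr; apply: ler_sum => e _.
  rewrite exprMn mulrA ler_wpM2r ?sqr_ge0// expr2 mulrA mulrC ler_pM2l//.
  rewrite /lambda invfM mulrCA ger_pMr// ler_pdivrMr// mul1r.
  exact: le_trans (theta_rho e) _.
have le2 : \sum_b eta2 * (nu.2 b).2.-1%:R ^+ 2 <= S.
  rewrite /S block_pythagoras.
  apply: (@le_trans _ _ (\sum_b block_size nu.1 b * dev nu b ^+ 2)).
    by apply: ler_sum => b _; exact: nuV.
  by rewrite lerDl; apply: sumr_ge0 => e _; rewrite sqr_ge0.
have le3 : \sum_b ((nu.2 b).2.-1%:R ^+ 2 : R) <= lambda / 32 * S.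
  rewrite -mulr_sumr in le2.
  have : lambda / 32 * eta2 = 1 by rewrite /lambda /eta2; field; rewrite gt_eqF.
  have l32 : 0 <= lambda / 32 by rewrite divr_ge0// ltW.
  by move=> Q; have := ler_wpM2l l32 le2; rewrite mulrA Q mul1r.
apply: (@le_trans _ _ (expR (\sum_b - ((nu.2 b).2.-1%:R ^+ 2)))).
  by rewrite ler_expR sumrN; lra.
by rewrite expR_sum; apply: ler_prod => b _; rewrite expR_ge0 exp_weight.
Qed.

Let sum_half_pow (n : nat) : \sum_(j < n) (2 / 2 ^+ j) <= 4 :> R.
Proof.
have : \sum_(j < n) (2 / 2 ^+ j) = 4 - 4 / 2 ^+ n :> R.
  elim: n => [|n IH]; first by rewrite big_ord0 expr0 divr1 subrr.
  rewrite big_ord_recr/= IH exprS; field; exact: expf_neq0.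
by move=> ->; rewrite lerBlDr lerDl divr_ge0// exprn_ge0.
Qed.

(** The weights form a product over blocks; each block contributes two signs times a geometric
    series of sum at most 4. *)
Lemma net_total_moment :
  \sum_(nu | valid nu) pexp (bern theta) (fun a => expR (Y nu a)) <=
  #|Z|%:R * 8 ^+ #|B|.
Proof.
apply: (@le_trans _ _ (\sum_(nu : net) \prod_b (2 / 2 ^+ (nu.2 b).2))).
  rewrite big_mkcond/=; apply: ler_sum => nu _; case: ifP => [|_].
    exact: net_moment.
  by apply: prodr_ge0 => b _; rewrite divr_ge0// exprn_ge0.
rewrite -(pair_bigA _ (fun (z : Z) (s : {ffun B -> bool * 'I_J}) =>
  \prod_b (2 / 2 ^+ (s b).2)))/=.
rewrite sumr_const -[leLHS]mulr_natl ler_wpM2l//.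
rewrite -(bigA_distr_bigA (fun (b : B) (t : bool * 'I_J) => 2 / 2 ^+ t.2)).
rewrite -(pair_bigA _ (fun (s : bool) (j : 'I_J) => 2 / 2 ^+ j))/= big_bool/=.
rewrite prodr_const lerXn2r ?nnegrE//.
  by rewrite addr_ge0//; apply: sumr_ge0 => j _; rewrite divr_ge0// exprn_ge0.
by have := sum_half_pow J; lra.
Qed.

Lemma net_approximates (a : {ffun E -> bool}) (z : Z) (Q : B -> R) :
  (forall e, `|Q (blk z e)| <= r) ->
  \sum_e ((a e)%:R - Q (blk z e)) ^+ 2 <= \sum_e ((a e)%:R - T e) ^+ 2 ->
  exists2 nu : net, valid nu &
  \sum_e (theta e - Q (blk z e)) ^+ 2 <=
    3 * \sum_e (theta e - T e) ^+ 2 + 256 * r * Y nu a + 1024 * r * #|B|%:R.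
Proof.
move=> Qr basic.
pose t b := Q b - block_mean z b.
pose X b := \sum_(e | blk z e == b) noise a e.
pose m b := block_size z b.
have m_pos b : m b != 0 -> exists e, blk z e = b.
  move=> mb; have [e /eqP eb|none] := pickP (fun e => blk z e == b); first by exists e.
  by move: mb; rewrite /m /block_size big_pred0// eqxx.
have X0 b : m b = 0 -> X b = 0.
  move=> mb; rewrite /X big_pred0// => e; apply/negP => /eqP eb.
  by have := block_size_ge1 z e; rewrite eb -/(m b) mb ler10.
have tr b : m b != 0 -> `|t b| <= 2 * r.
  move=> /m_pos[e <-]; have := block_mean_bounds z e; have := Qr e.
  rewrite /t !ler_norml => /andP[h1 h2] /andP[h3 h4]; apply/andP; split; move: rho_r; lra.
have m_gt0 b : m b != 0 -> 0 < m b by move=> mb; rewrite lt_def mb block_size_ge0.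
have h_gt0 b : m b != 0 -> 0 < h z b by move=> /m_gt0 mb; rewrite sqrtr_gt0 divr_gt0.
have mh2 b : m b != 0 -> m b * h z b ^+ 2 = eta2.
  move=> mb; rewrite sqr_sqrtr ?divr_ge0 ?block_size_ge0 ?ltW//.
  by rewrite mulrC divfK.
(* One-sided rounding: up where the deviation t and the block noise X have the same sign, to zero
   elsewhere. Hence t X <= dev X on every block. *)
pose j b : nat := if (m b != 0) && (0 < t b * X b)
  then (Num.truncn (`|t b| / h z b)).+1 else 0%N.
have trunc_le b : m b != 0 -> (Num.truncn (`|t b| / h z b))%:R <= `|t b| / h z b.
  by move=> mb; rewrite truncn_le// divr_ge0.
have jJ b : (j b < J)%N.
  rewrite /j; case: ifP => // /andP[mb _]; rewrite /J !ltnS.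
  have ti := trunc_le b mb; set i := Num.truncn _ in ti *.
  apply: (@leq_trans (Num.truncn (4 * r ^+ 2 * #|E|%:R / eta2))) => //.
  have hi := h_gt0 b mb.
  rewrite -[leqLHS](@natrK R)// ; apply: le_truncn.
  apply: (@le_trans _ _ (i%:R ^+ 2)).
    by rewrite -natrX ler_nat; case: (i) => // i'; rewrite leq_pmulr.
  have mE : m b <= #|E|%:R.
    rewrite /m /block_size -sumr_const.
    by rewrite [leRHS](bigID (fun e => blk z e == b))/= lerDl sumr_ge0.
  apply: (@le_trans _ _ ((`|t b| / h z b) ^+ 2)).
    by rewrite lerXn2r ?nnegrE ?divr_ge0.
  rewrite expr_div_n ler_pdivrMr ?exprn_gt0// -(mh2 b mb) (_ : _ / _ * _ = 4 * r ^+ 2 *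
      (#|E|%:R / m b)); last first.
    by field; rewrite mb gt_eqF.
  apply: (@le_trans _ _ ((2 * r) ^+ 2)); first by rewrite lerXn2r ?nnegrE ?mulr_ge0 ?tr// ltW.
  rewrite exprMn (_ : 2 ^+ 2 = 4); last by rewrite expr2; ring.
  have r2 : 0 <= 4 * r ^+ 2 by exact: mulr_ge0 (ler0n _ _) (sqr_ge0 r).
  by rewrite ler_peMr// ler_pdivlMr ?m_gt0// mul1r.
pose nu : net := (z, [ffun b => (t b < 0, inord (j b))]).
have nuj b : nat_of_ord (nu.2 b).2 = j b by rewrite ffunE/= inordK// -ltnS.
have devE b : dev nu b = (-1) ^+ (t b < 0)%R * amp z b (j b).
  by rewrite /dev nuj ffunE.
have amp0 b : amp z b 0 = 0.
  by rewrite /amp mul0r min_r// mulr_ge0// ltW.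
have j0 b : j b = 0%N -> dev nu b = 0 by move=> jb; rewrite devE jb amp0 mulr0.
have ampj b : j b != 0%N ->
    [/\ m b != 0, 0 < t b * X b, `|t b| <= amp z b (j b), amp z b (j b) <= `|t b| + h z b
      & (j b).-1%:R * h z b <= `|t b|].
  rewrite /j; case: ifP => // /andP[mb tX] _; have hb := h_gt0 b mb.
  have := trunc_le b mb; rewrite ler_pdivlMr// => t1.
  have := truncnS_gt (`|t b| / h z b); rewrite ltr_pdivrMr// => t2.
  split => //.
    by rewrite /amp le_min tr//= ltW.
  by rewrite /amp ge_min; apply/orP; right; rewrite -natr1 mulrDl mul1r lerD2r.
have nuV : valid nu.
  apply/forallP => b; rewrite nuj; have [jb|jb] := eqVneq (j b) 0%N.
    by rewrite jb/= expr0n/= mulr0 mulr_ge0 ?block_size_ge0 ?sqr_ge0.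
  have [mb tX t1 t2 t3] := ampj b jb.
  rewrite -(mh2 b mb) -mulrA ler_wpM2l ?block_size_ge0//.
  rewrite -exprMn mulrC -[leRHS]real_normK ?num_real// norm_dev nuj.
  rewrite lerXn2r ?nnegrE ?mulr_ge0 ?amp_ge0//.
  exact: le_trans t1.
exists nu => //.
have devX b : t b * X b <= dev nu b * X b.
  have [jb|jb] := eqVneq (j b) 0%N.
    rewrite (j0 b jb) mul0r; have [/X0->|mb] := eqVneq (m b) 0; first by rewrite mulr0.
    by move: jb; rewrite /j mb/=; case: ifP => // /negbT; rewrite -leNgt.
  have [mb tX t1 t2 t3] := ampj b jb.
  rewrite devE; have [t0|t0] := ltP (t b) 0.
    have Xb : X b < 0 by rewrite -(nmulr_rgt0 _ t0).
    rewrite expr1 mulN1r ler_wnM2r ?(ltW Xb)//.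
    by move: t1; rewrite ltr0_norm//; lra.
  have Xb : 0 < X b.
    have t0' : 0 < t b.
      by rewrite lt_neqAle t0 andbT; apply: contraL tX => /eqP <-; rewrite mul0r ltxx.
    by rewrite -(pmulr_rgt0 _ t0').
  by rewrite expr0 mul1r ler_wpM2r ?(ltW Xb)//; move: t1; rewrite ger0_norm.
have dev2 b : m b * dev nu b ^+ 2 <= 2 * (m b * t b ^+ 2) + 2 * eta2.
  have m0 := block_size_ge0 z b.
  have [jb|jb] := eqVneq (j b) 0%N.
    rewrite (j0 b jb) expr0n/= mulr0; have u1 := mulr_ge0 m0 (sqr_ge0 (t b));
        have u2 := eta2_gt0.
    by apply: addr_ge0; apply: mulr_ge0 => //; exact: ltW.
  have [mb tX t1 t2 t3] := ampj b jb.
  rewrite -(mh2 b mb) -[dev nu b ^+ 2]real_normK ?num_real// norm_dev nuj.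
  have : amp z b (j b) ^+ 2 <= (`|t b| + h z b) ^+ 2.
    by rewrite lerXn2r ?nnegrE ?addr_ge0 ?amp_ge0.
  have := sqr_ge0 (`|t b| - h z b); rewrite -[t b ^+ 2]real_normK ?num_real//.
  rewrite -/(m b) in m0.
  move=> u1 u2; have : amp z b (j b) ^+ 2 <= 2 * `|t b| ^+ 2 + 2 * h z b ^+ 2 by lra.
  by move=> /(ler_wpM2l m0); rewrite mulrDr [X in _ <= X + _]mulrCA [X in _ <= _ + X]mulrCA.
pose V := \sum_e (block_mean z (blk z e) - T e) ^+ 2.
pose NT := \sum_e (Q (blk z e) - T e) ^+ 2.
pose Nn := \sum_e pt nu e ^+ 2.
pose S := \sum_e (theta e - Q (blk z e)) ^+ 2.
pose S0 := \sum_e (theta e - T e) ^+ 2.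
have NTE : NT = \sum_b m b * t b ^+ 2 + V.
  rewrite -block_pythagoras; apply: eq_bigr => e _; congr (_ ^+ 2).
  by rewrite /t subrK.
have NnE : Nn = \sum_b m b * dev nu b ^+ 2 + V by exact: (block_pythagoras z (dev nu)).
have V0 : 0 <= V by apply: sumr_ge0 => e _; exact: sqr_ge0.
have Nn_le : Nn <= 2 * NT + 2 * eta2 * #|B|%:R.
  have : \sum_b m b * dev nu b ^+ 2 <= \sum_b (2 * (m b * t b ^+ 2) + 2 * eta2).
    by apply: ler_sum => b _; exact: dev2.
  rewrite big_split/= -mulr_sumr sumr_const -[X in _ + X]mulr_natr; lra.
pose IP := \sum_e (Q (blk z e) - T e) * noise a e.
have IP_le : IP <= \sum_e pt nu e * noise a e.
  have E1 : IP = \sum_b t b * X b + \sum_e (block_mean z (blk z e) - T e) * noise a e.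
    rewrite -sum_block -big_split; apply: eq_bigr => e _ /=; rewrite /t; ring.
  have E2 : \sum_e pt nu e * noise a e = \sum_b dev nu b * X b +
      \sum_e (block_mean z (blk z e) - T e) * noise a e.
    rewrite -sum_block -big_split; apply: eq_bigr => e _ /=; rewrite /pt/=; ring.
  by rewrite E1 E2 lerD2r; apply: ler_sum => b _; exact: devX.
have NT_le : NT <= 2 * S + 2 * S0.
  rewrite !mulr_sumr -big_split; apply: ler_sum => e _ /=.
  have := sqr_ge0 ((theta e - Q (blk z e)) + (theta e - T e)); lra.
have S_le : S <= S0 + 2 * IP.
  rewrite -subr_ge0.
  rewrite -subr_ge0 in basic; apply: (le_trans basic); rewrite le_eqVlt; apply/orP; left;
      apply/eqP.
  rewrite /S0 /IP /S mulr_sumr -big_split -!sumrB; apply: eq_bigr => e _ /=; ring.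
have YE : 64 * r * Y nu a = \sum_e pt nu e * noise a e - 16^-1 * Nn.
  rewrite /Y mulrBr !mulrA (_ : 64 * r * lambda = 1) ?mul1r//.
  by rewrite /lambda divff// gt_eqF// mulr_gt0.
(* Here 2 IP <= 128 r Y + Nn / 8 and Nn <= 4 S + 4 S0 + 2 eta2 |B|. Half of S is absorbed on the
   left; doubling gives the factors 3, 256 r and eta2 / 2 = 1024 r. *)
rewrite -/S -/S0; move: YE Nn_le; rewrite /eta2; move: (Y nu a) => y.
move: IP_le S_le NT_le; move: (\sum_e _) => ip.
lra.
Qed.

(** The net point depends on the data, so Y is bounded uniformly: 1 + u <= exp u gives Y <= L + exp
    (- L) * W, with W the sum of all the exponentials. This is linear in the moments and needs no
    tail integral. *)
Lemma least_squares_risk (G : pred {ffun E -> bool}) (zh : {ffun E -> bool} -> Z)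
    (Qh : {ffun E -> bool} -> B -> R) :
  (forall a e, G a -> `|Qh a (blk (zh a) e)| <= r) ->
  (forall a, G a -> \sum_e ((a e)%:R - Qh a (blk (zh a) e)) ^+ 2 <=
                    \sum_e ((a e)%:R - T e) ^+ 2) ->
  pexp (bern theta) (fun a => (G a)%:R *
      \sum_e (theta e - Qh a (blk (zh a) e)) ^+ 2) <=
  3 * \sum_e (theta e - T e) ^+ 2 +
  256 * r * (ln #|Z|%:R + 7 * #|B|%:R + 1).
Proof.
move=> Qr basic.
(* L dominates the logarithm of the total moment because 8 <= exp 3. These 3 |B| and the rounding
   cost 1024 r |B| make up the 7 |B|. *)
pose L := ln #|Z|%:R + 3 * #|B|%:R : R.
have [Z0|/prednK Zp] := posnP #|Z|.
  by have := card0_eq Z0 (zh [ffun=> true]); rewrite inE.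
have L0 : 0 <= L by rewrite addr_ge0 ?mulr_ge0// ln_ge0// ler1n -Zp.
pose W a := \sum_(nu | valid nu) expR (Y nu a).
have W0 a : 0 <= W a by apply: sumr_ge0 => nu _; exact: expR_ge0.
set S0 := \sum_e _ ^+ 2.
have S00 : 0 <= S0 by apply: sumr_ge0 => e _; exact: sqr_ge0.
have YW nu a : valid nu -> Y nu a <= L + expR (- L) * W a.
  move=> nuV; have h1 := expR_ge1Dx (Y nu a - L).
  have h2 : expR (Y nu a) <= W a.
    by rewrite /W (bigD1 nu)//= lerDl; apply: sumr_ge0 => *; exact: expR_ge0.
  have h3 : expR (Y nu a - L) <= expR (- L) * W a.
    by rewrite addrC expRD ler_wpM2l// expR_ge0.
  lra.
have r256 : 0 <= 256 * r by exact: mulr_ge0 (ler0n _ _) (ltW r0).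
have bnd a : (G a)%:R * \sum_e (theta e - Qh a (blk (zh a) e)) ^+ 2 <=
    (3 * S0 + 1024 * r * #|B|%:R + 256 * r * L) + 256 * r * expR (- L) * W a.
  have [Ga|_] := boolP (G a); rewrite ?mul1r ?mul0r; last first.
    have h1 := mulr_ge0 r256 (mulr_ge0 (expR_ge0 (- L)) (W0 a)).
    have h2 := mulr_ge0 r256 L0; have h3 := mulr_ge0 r256 (ler0n R #|B|).
    by move: h1; rewrite mulrA; lra.
  have [nu nuV /le_trans] := net_approximates (fun e => Qr a e Ga) (basic a Ga); apply.
  have := ler_wpM2l r256 (YW nu a nuV); rewrite mulrDr mulrA -/S0; lra.
apply: (le_trans (pexp_le (bern_ge0 theta01) bnd)).
rewrite pexpD pexp_cst; last exact: sum_bern.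
rewrite pexpZ pexp_sum.
have h1 : expR (- L) * \sum_(nu | valid nu) pexp (bern theta) (fun a => expR (Y nu a)) <= 1.
  apply: (le_trans (ler_wpM2l (expR_ge0 _) net_total_moment)).
  have e8 : 8 <= expR 3 :> R.
    have -> : (8 : R) = 2 ^+ 3 by rewrite -natrX.
    rewrite -[3]mulr1 expRM_natl lerXn2r ?nnegrE ?expR_ge0 ?ler0n//.
    by have := expR_ge1Dx (1 : R).
  have Zr : 0 < #|Z|%:R :> R by rewrite ltr0n -Zp.
  rewrite expRN (ler_pdivrMl _ _ (expR_gt0 _)) mulr1 /L expRD lnK ?posrE//.
  apply: ler_wpM2l (ltW Zr) _ _ _.
  by rewrite mulrC expRM_natl; apply: lerXn2r; rewrite ?nnegrE ?expR_ge0 ?ler0n.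
have := ler_wpM2l r256 h1; rewrite mulr1 mulrA /L; lra.
Qed.

End least_squares_risk.

(** * The two estimators *)

(* In [labelings] the fibers are classical sets; here they are finite sets. *)
Lemma labelingsP (n k n0 : nat) (z : {ffun 'I_n -> 'I_k}) :
  labelings n0 z <-> forall a, (n0 <= #|[set i | z i == a]%SET|)%N.
Proof.
have E a : #|[set i | z i == a]%SET| = #|[set i | z i == a]%classic|.
  by apply: eq_card => i; apply/idP/idP; rewrite !inE.
by split=> H a; move: (H a); rewrite E.
Qed.

(** While a class is below n0, k * n0 <= n forces another one above it. Moving a vertex from the
    latter to the former lowers the total deficit by one. *)
Lemma relabel_small_classes (k n n0 : nat) (l : {ffun 'I_n -> 'I_k}) :
  (k * n0 <= n)%N ->
  exists2 z, labelings n0 z &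
    (#|[set i | z i != l i]%SET| <=
     \sum_a (n0 - #|[set i | l i == a]%SET|))%N.
Proof.
move=> kn; have [m] := ubnP (\sum_a (n0 - #|[set i | l i == a]%SET|))%N.
elim: m l => // m IH l; rewrite ltnS => lm.
have [/forallP full|/forallPn[a]] := boolP [forall a, (n0 <= #|[set i | l i == a]%SET|)%N].
  by exists l; [exact/labelingsP|rewrite eq_card0// => i; rewrite inE eqxx].
rewrite -ltnNge => adef.
have [b bbig] : exists b, (n0 < #|[set i | l i == b]%SET|)%N.
  apply/existsP; rewrite -[[exists _, _]]negbK; apply/negP => /existsPn small.
  have : (\sum_b #|[set i | l i == b]%SET| < \sum_(b < k) n0)%N.
    rewrite (bigD1 a)//= [X in (_ < X)%N](bigD1 a)//= -addSn leq_add//.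
    by apply: leq_sum => b _; rewrite leqNgt small.
  rewrite sum_nat_const card_ord ltnNge => /negP; apply; apply: (leq_trans kn).
  rewrite -{1}(card_ord n) -sum1_card (partition_big l xpredT)//=.
  by apply: leq_sum => b _; rewrite -sum1_card; apply/eq_leq/eq_bigl => i; rewrite inE.
have [i lib] : exists i, l i == b.
  have /card_gt0P[i] : (0 < #|[set i | l i == b]%SET|)%N by exact: leq_ltn_trans bbig.
  by rewrite inE; exists i.
have ab : a != b.
  by apply: contraTneq adef => ->; rewrite -leqNgt ltnW.
pose l' : {ffun 'I_n -> 'I_k} := [ffun j => if j == i then a else l j].
have ca : #|[set j | l' j == a]%SET| = #|[set j | l j == a]%SET|.+1.
  rewrite (cardsD1 i) !inE ffunE !eqxx add1n; congr _.+1; apply: eq_card => j.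
  rewrite !inE ffunE; case: (eqVneq j i) => //= ->.
  by rewrite (eqP lib) eq_sym (negPf ab).
have cb : #|[set j | l j == b]%SET| = #|[set j | l' j == b]%SET|.+1.
  rewrite (cardsD1 i) !inE lib add1n; congr _.+1; apply: eq_card => j.
  by rewrite !inE ffunE; case: (eqVneq j i) => //= _; rewrite (negPf ab).
have cc c : c != a -> c != b -> #|[set j | l' j == c]%SET| = #|[set j | l j == c]%SET|.
  move=> ca' cb'; apply: eq_card => j; rewrite !inE ffunE; case: (eqVneq j i) => // ->.
  by rewrite (eqP lib) eq_sym (negPf ca') eq_sym (negPf cb').
have E : (\sum_c (n0 - #|[set i | l i == c]%SET|) =
          (\sum_c (n0 - #|[set i | l' i == c]%SET|)).+1)%N.
  rewrite (bigD1 a)//= [in RHS](bigD1 a)//= ca -addSn; congr (_ + _)%N.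
    by rewrite subnSK.
  apply: eq_bigr => c ca'; have [->|cb'] := eqVneq c b; last by rewrite cc.
  have z1 : (n0 - #|[set i | l i == b]%SET| = 0)%N by apply/eqP; rewrite subn_eq0 ltnW.
  by rewrite z1; apply/esym/eqP; rewrite subn_eq0 -ltnS -cb.
have [z zl zd] := IH l' ltac:(by move: lm; rewrite E).
exists z => //; rewrite E; apply: (@leq_trans (#|[set j | z j != l' j]%SET| + 1)); last first.
  by rewrite addn1.
rewrite -(cards1 i) -cardsUI; apply: leq_trans (leq_addr _ _).
apply: subset_leq_card; apply/fintype.subsetP => j; rewrite !inE ffunE.
by case: (j == i); rewrite ?orbT ?orbF.
Qed.

Section edges.
Context {R : realType} {n : nat}.

Lemma sum_edge (F : 'I_n * 'I_n -> R) :
  \sum_(e : edge n) F (val e) = \sum_(p : 'I_n * 'I_n | (p.2 < p.1)%N) F p.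
Proof. by rewrite -(big_sub [pred p : 'I_n * 'I_n | (p.2 < p.1)%N]). Qed.

Lemma sum_sym_edge (F : 'I_n -> 'I_n -> R) : (forall i j, F i j = F j i) ->
  \sum_i \sum_j F i j =
  \sum_i F i i + 2 * \sum_(e : edge n) F (val e).1 (val e).2.
Proof.
move=> Fsym; rewrite (sum_edge (fun p => F p.1 p.2)).
rewrite pair_bigA/= (bigID (fun p : 'I_n * 'I_n => p.1 == p.2))/=; congr (_ + _).
  rewrite (reindex_onto (fun i => (i, i)) fst)/=; last by move=> [i j] /= /eqP ->.
  by apply: eq_bigl => i; rewrite !eqxx.
rewrite (bigID (fun p : 'I_n * 'I_n => (p.2 < p.1)%N))/= mulr2n mulrDl !mul1r; congr (_ + _).
  by apply: eq_bigl => -[i j] /=; rewrite -val_eqE/= neq_ltn andbC; case: ltnP => //=;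
      rewrite ?orbT.
rewrite (reindex_inj (_ : injective (fun p : 'I_n * 'I_n => (p.2, p.1))))/=; last first.
  by move=> [i j] [i' j'] /= [-> ->].
rewrite (eq_bigr (fun p => F p.1 p.2)) => [|p _]; last exact: Fsym.
by apply: eq_bigl => -[i j] /=; rewrite -val_eqE/= neq_ltn -leqNgt; case: ltngtP.
Qed.

Lemma sum_edge_ends (f : 'I_n -> R) : (forall i, 0 <= f i) ->
  \sum_(e : edge n) (f (val e).1 + f (val e).2) <= n%:R * \sum_i f i.
Proof.
move=> f0; have := @sum_sym_edge (fun i j => f i + f j) (fun i j => addrC _ _).
have -> : \sum_i \sum_j (f i + f j) = 2 * (n%:R * \sum_i f i).
  under eq_bigr => i _ do rewrite big_split/= sumr_const card_ord -mulr_natl.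
  rewrite big_split/= sumr_const card_ord -mulr_sumr -[X in _ + X]mulr_natl; ring.
have : 0 <= \sum_i (f i + f i) by apply: sumr_ge0 => i _; rewrite addr_ge0.
lra.
Qed.

Lemma card_edge_le : (#|{: edge n}| <= n * n)%N.
Proof.
by have := leq_card (val : edge n -> 'I_n * 'I_n) val_inj; rewrite card_prod !card_ord.
Qed.
End edges.

Section block_models.
Context {R : realType} {k n : nat}.
Implicit Types (z : {ffun 'I_n -> 'I_k}) (e : edge n) (a : observations n).

(** The pair is ordered, so (b, c) and (c, b) are different blocks: the risk bound asks for no
    symmetry and only counts k^2 blocks. The averages taken by a symmetric minimizer run over the
    union [sym_block]. *)
Definition edge_block z e : 'I_k * 'I_k := (z (val e).1, z (val e).2).

Definition edges_between (S T : {set 'I_n}) : {set edge n} :=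
  [set e : edge n | ((val e).1 \in S) && ((val e).2 \in T) ||
           ((val e).1 \in T) && ((val e).2 \in S)]%SET.

Definition fiber z (b : 'I_k) : {set 'I_n} := [set i | z i == b]%SET.

Definition sym_block z (b : 'I_k * 'I_k) : {set edge n} :=
  edges_between (fiber z b.1) (fiber z b.2).

Lemma in_sym_block z b e : (e \in sym_block z b) =
  (edge_block z e == b) || (edge_block z e == (b.2, b.1)).
Proof. by case: b => b1 b2; rewrite !inE /edge_block !xpair_eqE. Qed.

Lemma block_mx_of_edge (Q : 'M[R]_k) z e :
  block_mx_of (Q, z) (val e).1 (val e).2 = Q (edge_block z e).1 (edge_block z e).2.
Proof. by rewrite mxE/= (valP e). Qed.

(** Putting the average w in place of the value of Q on the block changes the criterion by - |D| (Q
    - w)^2, so minimality forces equality. Only blocks containing an edge are constrained, hence the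
    quantification over edges. *)
Lemma least_squares_block_mean n0 a (Q : 'M[R]_k) z :
  minimizer_on [set Qz | Qz.1^T = Qz.1 /\ labelings n0 Qz.2]
    (@ls_criterion R n k a) (Q, z) ->
  forall e, Q (edge_block z e).1 (edge_block z e).2 * #|sym_block z (edge_block z e)|%:R =
    \sum_(e' in sym_block z (edge_block z e)) (a e')%:R.
Proof.
move=> [[Qsym zn0] Qmin] e; rewrite /= in Qsym zn0; move Eb : (edge_block z e) => b;
    set D := sym_block z b.
have D0 : 0 < #|D|%:R :> R.
  by rewrite ltr0n; apply/card_gt0P; exists e; rewrite in_sym_block Eb eqxx.
set v := \sum_(e' in D) (a e')%:R : R.
pose w := v / #|D|%:R.
pose inb (i j : 'I_k) := ((i, j) == b) || ((i, j) == (b.2, b.1)).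
pose Q' : 'M[R]_k := \matrix_(i, j) if inb i j then w else Q i j.
have Qb i j : inb i j -> Q i j = Q b.1 b.2.
  move=> /orP[/eqP <-//|/eqP [-> ->]]; by rewrite -[in LHS]Qsym mxE.
have Q'sym : Q'^T = Q'.
  apply/matrixP => i j; rewrite !mxE.
  have -> : inb j i = inb i j.
    by rewrite /inb; case: (b) => b1 b2 /=; rewrite !xpair_eqE orbC andbC (andbC (j == b1)).
  by case: ifP => // _; rewrite -[in LHS]Qsym mxE.
have := Qmin (Q', z) (conj Q'sym zn0).
rewrite /ls_criterion/= -subr_ge0 -sumrB.
have -> : \sum_(e' : edge n) (((a e')%:R - Q' (z (val e').1) (z (val e').2)) ^+ 2 -
      ((a e')%:R - Q (z (val e').1) (z (val e').2)) ^+ 2) =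
    \sum_(e' in D) (((a e')%:R - w) ^+ 2 - ((a e')%:R - Q b.1 b.2) ^+ 2).
  rewrite [RHS]big_mkcond/=; apply: eq_bigr => e' _; rewrite mxE in_sym_block -/(inb _ _).
  by case: ifP => [/Qb -> //|_]; rewrite subrr.
have -> : \sum_(e' in D) (((a e')%:R - w) ^+ 2 - ((a e')%:R - Q b.1 b.2) ^+ 2) =
    \sum_(e' in D) ((2 * (Q b.1 b.2 - w)) * (a e')%:R + (w ^+ 2 - Q b.1 b.2 ^+ 2)).
  by apply: eq_bigr => e' _; ring.
rewrite big_split/= -mulr_sumr sumr_const -[X in _ + X]mulr_natl -/v.
have -> : v = w * #|D|%:R by rewrite divfK// gt_eqF.
have -> : 2 * (Q b.1 b.2 - w) * (w * #|D|%:R) + #|D|%:R * (w ^+ 2 - Q b.1 b.2 ^+ 2) =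
  - (#|D|%:R * (Q b.1 b.2 - w) ^+ 2) by ring.
rewrite oppr_ge0 pmulr_rle0// => h.
have : (Q b.1 b.2 - w) ^+ 2 == 0 by rewrite eq_le h sqr_ge0.
by rewrite sqrf_eq0 subr_eq0 => /eqP ->.
Qed.

Lemma least_squares_block_bounds n0 a (Q : 'M[R]_k) z :
  minimizer_on [set Qz | Qz.1^T = Qz.1 /\ labelings n0 Qz.2]
    (@ls_criterion R n k a) (Q, z) ->
  forall e, 0 <= Q (edge_block z e).1 (edge_block z e).2 <= 1.
Proof.
move=> /least_squares_block_mean mean e; have := mean e.
have D0 : 0 < #|sym_block z (edge_block z e)|%:R :> R.
  by rewrite ltr0n; apply/card_gt0P; exists e; rewrite in_sym_block eqxx.
move=> H; apply/andP; split.
  by rewrite -(pmulr_lge0 _ D0) H; apply: sumr_ge0.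
rewrite -(ler_pM2r D0) mul1r H -sumr_const; apply: ler_sum => e' _.
by rewrite lern1; case: (a e').
Qed.

Variables (q : 'I_k -> 'I_k -> R) (rho : R).
Hypothesis q_rho : forall b c, 0 <= q b c <= rho.
Hypothesis q_sym : forall b c, q b c = q c b.
Hypothesis rho1 : rho <= 1.

Definition block_rate z e : R := q (z (val e).1) (z (val e).2).

Lemma block_rate01 z e : 0 <= block_rate z e <= 1.
Proof. by have /andP[-> /le_trans] := q_rho (z (val e).1) (z (val e).2); apply. Qed.

Lemma block_rate_le z e : block_rate z e <= rho.
Proof. by have /andP[] := q_rho (z (val e).1) (z (val e).2). Qed.

(** An edge contributes only if one of its ends was moved, and a vertex has fewer than n edges. *)
Lemma relabel_bias z l :
  \sum_e (block_rate l e - block_rate z e) ^+ 2 <=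
  rho ^+ 2 * (n%:R * #|[set i | z i != l i]%SET|%:R).
Proof.
have -> : #|[set i | z i != l i]%SET|%:R = \sum_i (z i != l i)%:R :> R.
  rewrite -sum1_card natr_sum big_mkcond/=; apply: eq_bigr => i _.
  by rewrite inE; case: ifP.
apply: le_trans (ler_wpM2l (sqr_ge0 rho) (sum_edge_ends _)) => //.
rewrite mulr_sumr; apply: ler_sum => e _.
have sq_le : (block_rate l e - block_rate z e) ^+ 2 <= rho ^+ 2.
  have /andP[h1 h2] := q_rho (l (val e).1) (l (val e).2).
  have /andP[h3 h4] := q_rho (z (val e).1) (z (val e).2).
  rewrite -[leLHS]real_normK ?num_real// lerXn2r ?nnegrE//; first exact: le_trans h2.
  by rewrite ler_norml /block_rate; apply/andP; split; lra.
have [e1|_] := eqVneq (z (val e).1) (l (val e).1); last first.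
  apply: (le_trans sq_le); rewrite ler_peMr ?sqr_ge0//.
  by rewrite lerDl.
have [e2|_] := eqVneq (z (val e).2) (l (val e).2); last first.
  apply: (le_trans sq_le); rewrite ler_peMr ?sqr_ge0//.
  by rewrite lerDr.
by rewrite /block_rate e1 e2 subrr expr0n/= addr0 mulr0.
Qed.

Definition oracle_mx : 'M[R]_k := \matrix_(b, c) q b c.

Lemma oracle_mx_sym : oracle_mx^T = oracle_mx.
Proof. by apply/matrixP => b c; rewrite !mxE. Qed.

Lemma ln_card_labelings : (0 < k)%N -> ln #|{: {ffun 'I_n -> 'I_k}}|%:R = n%:R * ln k%:R :> R.
Proof.
by move=> k0; rewrite card_ffun !card_ord natrX lnXn ?ltr0n// mulr_natl.
Qed.

Lemma card_block_pairs : #|{: 'I_k * 'I_k}|%:R = k%:R ^+ 2 :> R.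
Proof. by rewrite card_prod card_ord natrM. Qed.

(** Admissible labelings are surjective; filling the empty classes moves at most k vertices, whence
    the bias rho^2 n k. The bound on the block values is part of the constraint, so no event is
    excluded. *)
Lemma restricted_least_squares_risk (r : R) l (That : observations n -> 'M[R]_n) :
  (2 <= k)%N -> (k <= n)%N -> 0 < r -> rho <= r ->
  (forall a, is_restricted_least_squares k r a (That a)) ->
  pexp (bern (block_rate l))
    (fun a => \sum_e (block_rate l e - That a (val e).1 (val e).2) ^+ 2) <=
  3 * rho ^+ 2 * (n%:R * k%:R) + 256 * r * (n%:R * ln k%:R + 7 * k%:R ^+ 2 + 1).
Proof.
move=> k2 kn r0 rr LS.
have /choice[Qz HQz] a : exists Qz : 'M[R]_k * {ffun 'I_n -> 'I_k}, minimizer_on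
                [set Qz | [/\ Qz.1^T = Qz.1, forall b c, `|Qz.1 b c| <= r
                            & labelings 1 Qz.2]] (ls_criterion a) Qz /\ That a = block_mx_of Qz.
  by have [Qz] := LS a; exists Qz.
have [z zl zd] := @relabel_small_classes k n 1 l ltac:(by rewrite muln1).
have zdk : (#|[set i | z i != l i]%SET| <= k)%N.
  apply: (leq_trans zd); rewrite -[leqRHS]card_ord -sum1_card.
  by apply: leq_sum => b _; exact: leq_subr.
have := @least_squares_risk R _ _ _ (block_rate l) (block_rate z) edge_block rho r
  (block_rate01 l) (block_rate_le l) (fun e => q_rho _ _) rr r0
  xpredT (fun a => (Qz a).2) (fun a b => (Qz a).1 b.1 b.2).
rewrite ln_card_labelings ?card_block_pairs; last exact: leq_trans k2.
move=> H; apply: (le_trans _ (le_trans (H _ _) _)).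
- apply: pexp_le => [e b|a]; first by apply: bern_ge0; exact: block_rate01.
  rewrite mul1r; apply: ler_sum => e _; have [_ ->] := HQz a.
  by case: (Qz a) => Q zz; rewrite block_mx_of_edge.
- by move=> a e _; have [[[/= _ + _] _] _] := HQz a; apply.
- move=> a _; have [[_ /(_ (oracle_mx, z)) opt] _] := HQz a.
  have -> : \sum_e ((a e)%:R - block_rate z e) ^+ 2 = ls_criterion a (oracle_mx, z).
    by apply: eq_bigr => e _; rewrite mxE.
  apply: opt; split => //=; first exact: oracle_mx_sym.
  move=> b c; rewrite mxE; have /andP[h1 h2] := q_rho b c.
  by rewrite ger0_norm// (le_trans h2).
rewrite lerD2r -mulrA ler_wpM2l//; apply: (le_trans (relabel_bias _ _)).
by rewrite ler_wpM2l ?sqr_ge0// ler_wpM2l// ler_nat.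
Qed.

End block_models.

(** * Pairs of vertex sets with too many edges *)

Lemma sum_subsets_pow (R : realType) (T : finType) (x : R) :
  \sum_(S : {set T}) x ^+ #|S| = (1 + x) ^+ #|T|.
Proof.
have -> : (1 + x) ^+ #|T| = \prod_(i : T) (x + 1) by rewrite prodr_const addrC.
rewrite bigA_distr/=.
by apply: eq_bigr => S _; rewrite -prodr_const big_mkcond.
Qed.

(** Twelve of the thirteen powers of k are spent on |S| >= n0. The last one leaves (1 + 1/k)^n as
    the sum over all subsets, at most exp (n / k) <= exp (4 n0) <= k^(8 n0). *)
Lemma sum_large_subsets_pow (R : realType) (k n n0 : nat) (x : R) :
  (2 <= k)%N -> (n <= 4 * k * n0)%N -> 0 <= x -> x <= (k%:R ^+ 13)^-1 ->
  \sum_(S : {set 'I_n} | (n0 <= #|S|)%N) x ^+ #|S| <= (k%:R ^+ (4 * n0))^-1.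
Proof.
move=> k2 nk x0 xk.
have k0 : 0 < k%:R :> R by rewrite ltr0n ltnW.
have k1 : 1 <= k%:R :> R by rewrite ler1n ltnW.
pose c : R := (k%:R ^+ (12 * n0))^-1.
have c0 : 0 <= c by rewrite invr_ge0 exprn_ge0// ltW.
apply: (@le_trans _ _ (\sum_(S : {set 'I_n}) c * k%:R^-1 ^+ #|S|)).
  rewrite big_mkcond/=; apply: ler_sum => S _; case: ifP => [n0S|_]; last first.
    by rewrite mulr_ge0// exprn_ge0// invr_ge0 ltW.
  apply: (@le_trans _ _ ((k%:R ^+ 13)^-1 ^+ #|S|)).
    by rewrite lerXn2r ?nnegrE// invr_ge0 exprn_ge0// ltW.
  rewrite /c !exprVn -invfM lef_pV2 ?posrE ?mulr_gt0 ?exprn_gt0//.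
  rewrite -exprD -exprM; apply: ler_weXn2l => //.
  by rewrite -[(13 * _)%N]/((12 + 1) * #|S|)%N mulnDl mul1n leq_add2r leq_mul2l n0S orbT.
rewrite -mulr_sumr sum_subsets_pow card_ord.
have h1 : (1 + k%:R^-1) ^+ n <= k%:R ^+ (8 * n0) :> R.
  apply: (@le_trans _ _ (expR (n%:R * k%:R^-1))).
    by rewrite expRM_natl lerXn2r ?nnegrE ?expR_ge0 ?addr_ge0 ?invr_ge0 ?expR_ge1Dx// ltW.
  apply: (@le_trans _ _ (expR ((8 * n0)%:R * 2^-1))).
    rewrite ler_expR ler_pdivrMr// natrM.
    have : n%:R <= 4 * k%:R * n0%:R :> R by rewrite -!natrM ler_nat.
    lra.
  rewrite expRM_natl lerXn2r ?nnegrE ?expR_ge0 ?ler0n//.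
  apply: (@le_trans _ _ 2); last by rewrite ler_nat.
  have : expR (2^-1 : R) <= 1 + 2^-1 + 2 * 2^-1 ^+ 2.
    by apply: expR_le_quadratic; rewrite ger0_norm.
  lra.
apply: (le_trans (ler_wpM2l c0 h1)).
rewrite /c (_ : (12 * n0 = 8 * n0 + 4 * n0)%N); last by lia.
rewrite exprD invfM mulrAC mulVf ?mul1r//.
by rewrite expf_neq0// gt_eqF.
Qed.

Lemma in_edges_between (n : nat) (S T : {set 'I_n}) (e : edge n) :
  (e \in edges_between S T) = ((val e).1 \in S) && ((val e).2 \in T) ||
                              ((val e).1 \in T) && ((val e).2 \in S).
Proof. by rewrite inE. Qed.

Section dense_blocks.
Context {R : realType} {n : nat} (theta : edge n -> R) (rho r : R) (n0 : nat).
Hypothesis theta01 : forall e, 0 <= theta e <= 1.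
Hypothesis theta_rho : forall e, theta e <= rho.
Hypothesis rho_r : 4 * rho <= r.
Hypothesis rho0 : 0 < rho.

(* The union runs over pairs of vertex sets, weighted by their sizes: a union over
   labelings would be too large for the available exponential decay. *)
Definition dense_pair (a : observations n) (p : {set 'I_n} * {set 'I_n}) : bool :=
  [&& (n0 <= #|p.1|)%N, (n0 <= #|p.2|)%N,
      (#|p.1| * #|p.2| <= 4 * #|edges_between p.1 p.2|)%N &
      r * #|edges_between p.1 p.2|%:R < \sum_(e in edges_between p.1 p.2) (a e)%:R].

(** Chernoff's bound with exponent 1/2: the mean costs rho |D| <= r |D| / 4 against a gain of r |D|
    / 2. What remains is at least r |S| |T| / 16 >= r n0 (|S| + |T|) / 32, additive in the sizes, so
    the sum over pairs factors. *)
Lemma dense_pair_probability :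
  pexp (bern theta) (fun a => [exists p, dense_pair a p]%:R) <=
  (\sum_(S : {set 'I_n} | (n0 <= #|S|)%N) expR (- (r * n0%:R / 32)) ^+ #|S|) ^+ 2.
Proof.
have r0 : 0 < r by move: rho_r rho0; lra.
set x := expR (- _).
pose ok (p : {set 'I_n} * {set 'I_n}) := [&& (n0 <= #|p.1|)%N, (n0 <= #|p.2|)%N &
      (#|p.1| * #|p.2| <= 4 * #|edges_between p.1 p.2|)%N].
pose D (p : {set 'I_n} * {set 'I_n}) := edges_between p.1 p.2.
pose W p (a : observations n) : R :=
  expR (- (2^-1 * (r * #|D p|%:R))) * expR (2^-1 * \sum_(e in D p) (a e)%:R).
have W0 p a : 0 <= W p a by rewrite mulr_ge0 ?expR_ge0.
apply: (@le_trans _ _ (pexp (bern theta) (fun a => \sum_(p | ok p) W p a))).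
  apply: pexp_le => [e b|a]; first by apply: bern_ge0.
  have [/existsP[p /and4P[p1 p2 p3 p4]]|_] := boolP [exists p, dense_pair a p];
      last by apply: sumr_ge0 => p _; exact: W0.
  apply: (@le_trans _ _ (W p a)); last first.
    by rewrite (bigD1 p) /ok ?p1 ?p2//= lerDl; apply: sumr_ge0 => ? _; exact: W0.
  rewrite /W -expRD; apply: (le_trans _ (expR_ge1Dx _)).
  rewrite lerDl addrC -mulrBr mulr_ge0// subr_ge0; exact: ltW.
rewrite pexp_sum.
apply: (@le_trans _ _ (\sum_(p : {set 'I_n} * {set 'I_n} | (n0 <= #|p.1|)%N && (n0 <= #|p.2|)%N)
    x ^+ #|p.1| * x ^+ #|p.2|)); last first.
  rewrite -(pair_big (fun S : {set 'I_n} => n0 <= #|S|)%N (fun S : {set 'I_n} => n0 <= #|S|)%N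
     (fun S T : {set 'I_n} => x ^+ #|S| * x ^+ #|T|))/= expr2 mulr_suml le_eqVlt.
  by apply/orP; left; apply/eqP; apply: eq_bigr => S _; rewrite mulr_sumr.
rewrite big_mkcond [leRHS]big_mkcond; apply: ler_sum => -[S T] _ /=.
rewrite /ok /=; have [nS|_] /= := leqP n0 #|S|; last by [].
have [nT|_] /= := leqP n0 #|T|; last by [].
case: ifP => [STD|_]; last by rewrite mulr_ge0// exprn_ge0// expR_ge0.
rewrite pexpZ; apply: (le_trans (ler_wpM2l (expR_ge0 _) (bern_half_exp_le theta01 _))).
rewrite -exprD -expRM_natl -expRD ler_expR.
have h1 : \sum_(e in D (S, T)) theta e <= #|D (S, T)|%:R * rho.
  rewrite -[#|_|%:R]sumr_const mulr_suml; apply: ler_sum => e _; rewrite mul1r.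
  exact: theta_rho.
have h2 : #|S|%:R * #|T|%:R <= 4 * #|D (S, T)|%:R :> R by rewrite -!natrM ler_nat.
have h3 : n0%:R <= #|S|%:R :> R by rewrite ler_nat.
have h4 : n0%:R <= #|T|%:R :> R by rewrite ler_nat.
have h5 : n0%:R * (#|S|%:R + #|T|%:R) <= 2 * (#|S|%:R * #|T|%:R) :> R.
  have := ler_wpM2r (ler0n R #|T|) h3; have := ler_wpM2r (ler0n R #|S|) h4; lra.
have h6 : 0 <= #|D (S, T)|%:R :> R by [].
rewrite natrD; move: h1 h2 h5 h6; move: (\sum_(e in _) _) (#|D _|%:R) => y d.
move=> h1 h2 h5 h6.
have h7 : d * (4 * rho) <= d * r by rewrite ler_wpM2l.
have h8 : r * (n0%:R * (#|S|%:R + #|T|%:R)) <= r * (8 * d) by rewrite ler_pM2l//; lra.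
lra.
Qed.

(** Two fibers are disjoint or equal. Disjoint ones span |S| |T| edges; a single fiber of size s
    spans s (s - 1) / 2, at least s^2 / 4 once s >= 2, hence the condition on n0. *)
Lemma edges_between_fibers (k : nat) (z : {ffun 'I_n -> 'I_k}) (b c : 'I_k) :
  (2 <= n0)%N -> (n0 <= #|fiber z b|)%N ->
  (#|fiber z b| * #|fiber z c| <= 4 * #|edges_between (fiber z b) (fiber z c)|)%N.
Proof.
move=> n2 nb; set S := fiber z b; set T := fiber z c.
pose F (i j : 'I_n) : R := ((i \in S) && (j \in T) || (i \in T) && (j \in S))%:R.
have Fsym i j : F i j = F j i by rewrite /F orbC; congr (nat_of_bool (_ || _))%:R;
    rewrite andbC.
have card_natr (A : {set 'I_n}) : #|A|%:R = \sum_i (i \in A)%:R :> R.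
  by rewrite -sum1_card natr_sum big_mkcond/=; apply: eq_bigr => i _; case: ifP.
have := sum_sym_edge Fsym.
have -> : \sum_(e : edge n) F (val e).1 (val e).2 = #|edges_between S T|%:R.
  rewrite -sum1_card natr_sum [RHS]big_mkcond/=; apply: eq_bigr => e _.
  by rewrite in_edges_between /F; case: (_ || _).
have le1 : #|S|%:R * #|T|%:R <= \sum_i \sum_j F i j.
  rewrite !card_natr mulr_suml; apply: ler_sum => i _; rewrite mulr_sumr.
  by apply: ler_sum => j _; rewrite -natrM ler_nat /F; case: (_ \in S); case: (_ \in T).
have le2 : 2 * \sum_i F i i <= #|S|%:R * #|T|%:R.
  have [bc|bc] := eqVneq b c.
    have TS : T = S by rewrite /S /T bc.
    have -> : \sum_i F i i = #|S|%:R.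
      by rewrite card_natr; apply: eq_bigr => i _; rewrite /F TS orbb andbb.
    by rewrite TS -!natrM ler_nat leq_mul2r (leq_trans n2 nb) orbT.
  rewrite big1 ?mulr0 ?mulr_ge0// => i _; rewrite /F !inE.
  case: eqVneq => [->|_] /=; last by rewrite andbF.
  by rewrite (negPf bc).
move=> E; rewrite -(ler_nat R) !natrM; lra.
Qed.

End dense_blocks.

Section least_squares_estimator.
Context {R : realType} {k n : nat}.
Variables (q : 'I_k -> 'I_k -> R) (rho : R).
Hypothesis q_rho : forall b c, 0 <= q b c <= rho.
Hypothesis q_sym : forall b c, q b c = q c b.
Hypothesis rho1 : rho <= 1.
Variables (n0 : nat) (l : {ffun 'I_n -> 'I_k}) (That : observations n -> 'M[R]_n).
Hypothesis LS : forall a, is_least_squares k n0 a (That a).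

Local Notation loss a :=
  (\sum_(e : edge n) (block_rate q l e - That a (val e).1 (val e).2) ^+ 2).

Lemma least_squares_choice : exists Qz : observations n -> 'M[R]_k * {ffun 'I_n -> 'I_k},
  forall a, minimizer_on [set Qz | Qz.1^T = Qz.1 /\ labelings n0 Qz.2]
     (ls_criterion a) (Qz a) /\ That a = block_mx_of (Qz a).
Proof.
have /choice[Qz HQz] a : exists Qz : 'M[R]_k * {ffun 'I_n -> 'I_k},
    minimizer_on [set Qz | Qz.1^T = Qz.1 /\ labelings n0 Qz.2] (ls_criterion a) Qz /\
    That a = block_mx_of Qz by have [Qz] := LS a; exists Qz.
by exists Qz.
Qed.

Lemma least_squares_loss_le a : loss a <= n%:R ^+ 2.
Proof.
have [Qz HQz] := least_squares_choice.
apply: (@le_trans _ _ (\sum_(e : edge n) 1)); last first.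
  by rewrite sumr_const -natrX ler_nat; exact: card_edge_le.
apply: ler_sum => e _; have [Qmin ->] := HQz a; case: (Qz a) Qmin => Q z Qmin.
rewrite block_mx_of_edge.
have /andP[h1 h2] := least_squares_block_bounds Qmin e.
have /andP[h3 h4] := block_rate01 q_rho rho1 l e.
rewrite -[leLHS]real_normK ?num_real// -[leRHS](expr1n _ 2) lerXn2r ?nnegrE//.
by rewrite ler_norml; apply/andP; split; lra.
Qed.

(** The last summand 1 is the crude loss n^2 times the probability n^(-2) of a dense pair. The
    condition on ln k makes the weight per vertex at most k^(-13). *)
Lemma least_squares_estimator_risk (r : R) :
  (2 <= k)%N -> (2 <= n0)%N -> (k * n0 <= n)%N -> (n <= 4 * k * n0)%N ->
  0 < rho -> 4 * rho <= r -> 13 * ln k%:R <= r * n0%:R / 32 ->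
  pexp (bern (block_rate q l)) (fun a => loss a) <=
  3 * rho ^+ 2 * (n%:R * \sum_b (n0 - #|[set i | l i == b]%SET|)%:R) +
  256 * r * (n%:R * ln k%:R + 7 * k%:R ^+ 2 + 1) + 1.
Proof.
move=> k2 n02 kn nk rho0 rho_r lnk.
have r0 : 0 < r by lra.
have rr : rho <= r by lra.
have [Qz HQz] := least_squares_choice.
have [z zl zd] := @relabel_small_classes k n n0 l kn.
have th01 := block_rate01 q_rho rho1 (n := n) l.
pose G : pred (observations n) := fun a => ~~ [exists p, dense_pair r n0 a p].
have := @least_squares_risk R _ _ _ (block_rate q l) (block_rate q z) edge_block rho r
  th01 (block_rate_le q_rho l) (fun e => q_rho _ _) rr r0
  G (fun a => (Qz a).2) (fun a b => (Qz a).1 b.1 b.2).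
rewrite ln_card_labelings ?card_block_pairs; last exact: leq_trans k2.
have Qbound a e : G a -> `|(Qz a).1 (edge_block (Qz a).2 e).1 (edge_block (Qz a).2 e).2| <= r.
  rewrite /G negb_exists => /forallP dens; have [Qmin _] := HQz a.
  case: (Qz a) Qmin => Q zz Qmin /=.
  have /andP[h1 _] := least_squares_block_bounds Qmin e.
  rewrite ger0_norm//.
  have := least_squares_block_mean Qmin e; set b := edge_block zz e => mean.
  have D0 : 0 < #|sym_block zz b|%:R :> R.
    by rewrite ltr0n; apply/card_gt0P; exists e; rewrite in_sym_block eqxx.
  have /labelingsP zn : labelings n0 zz by case: Qmin => -[].
  have := dens (fiber zz b.1, fiber zz b.2); rewrite /dense_pair /= !zn/=.
  rewrite (@edges_between_fibers R _ n0)//=; last exact: zn.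
  by rewrite -leNgt -/(sym_block zz b) -mean ler_pM2r.
have opt a : G a -> \sum_e ((a e)%:R - (Qz a).1 (edge_block (Qz a).2 e).1 (edge_block (Qz
    a).2 e).2) ^+ 2 <=
   \sum_e ((a e)%:R - block_rate q z e) ^+ 2.
  move=> _; have [[_ /(_ (oracle_mx q, z)) opt] _] := HQz a.
  have -> : \sum_e ((a e)%:R - block_rate q z e) ^+ 2 = ls_criterion a (oracle_mx q, z).
    by apply: eq_bigr => e _; rewrite mxE.
  by apply: opt; split => //=; exact: oracle_mx_sym.
move=> /(_ Qbound opt) risk.
have split_le a : loss a <= (G a)%:R * \sum_e (block_rate q l e -
    (Qz a).1 (edge_block (Qz a).2 e).1 (edge_block (Qz a).2 e).2) ^+ 2 +
    n%:R ^+ 2 * [exists p, dense_pair r n0 a p]%:R.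
  rewrite /G; have [_|_] := boolP [exists p, dense_pair r n0 a p]; rewrite /=; last first.
    rewrite mul1r mulr0 addr0; apply: ler_sum => e _.
    by have [_ ->] := HQz a; case: (Qz a) => Q zz; rewrite block_mx_of_edge.
  by rewrite mul0r add0r mulr1; exact: least_squares_loss_le.
apply: (le_trans (pexp_le (bern_ge0 th01) split_le)).
rewrite pexpD pexpZ.
apply: lerD.
  apply: (le_trans risk); rewrite lerD2r -mulrA ler_wpM2l//.
  apply: (le_trans (relabel_bias q_rho _ _)).
  rewrite ler_wpM2l ?sqr_ge0// ler_wpM2l// -natr_sum ler_nat.
  exact: zd.
have k0 : 0 < k%:R :> R by rewrite ltr0n ltnW.
have prob := @dense_pair_probability R n (block_rate q l) rho r n0 th01 (block_rate_le
    q_rho l) rho_r rho0.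
apply: (@le_trans _ _ (n%:R ^+ 2 * ((k%:R ^+ (4 * n0))^-1 ^+ 2))).
  rewrite ler_wpM2l ?exprn_ge0//; apply: (le_trans prob).
  have x0 : 0 <= expR (- (r * n0%:R / 32)) by exact: expR_ge0.
  apply: lerXn2r; rewrite ?nnegrE.
  - by apply: sumr_ge0 => S _; rewrite exprn_ge0.
  - by rewrite invr_ge0 exprn_ge0// ltW.
  - apply: sum_large_subsets_pow => //.
    rewrite expRN lef_pV2 ?posrE ?exprn_gt0 ?expR_gt0//.
    by rewrite -[X in X ^+ _]lnK ?posrE// -expRM_natl ler_expR.
rewrite -exprMn -[leRHS](expr1n _ 2) lerXn2r ?nnegrE ?divr_ge0 ?exprn_ge0//.
rewrite ler_pdivrMr ?exprn_gt0// mul1r -natrX ler_nat.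
apply: (leq_trans nk).
(* The chain is n <= 4 k n0 <= k^2 * k * k^n0, with exponent n0 + 3 <= 4 n0. *)
have n0k : (n0 <= k ^ n0)%N by apply: ltnW; exact: ltn_expl.
apply: (@leq_trans (k ^ 2 * k * k ^ n0)%N).
  have k4 : (4 <= k ^ 2)%N by rewrite -[4%N]/(2 ^ 2)%N leq_exp2r.
  by apply: leq_mul => //; rewrite leq_mul2r k4 orbT.
rewrite -{2}(expn1 k) -!expnD leq_exp2l//; lia.
Qed.

End least_squares_estimator.

(** * Hidden labels *)

Lemma pexp_centered_sum_sqr (R : realType) (I T : finType) (p x : T -> R) :
  \sum_t p t = 1 -> \sum_t p t * x t = 0 ->
  pexp (fun _ : I => p) (fun f => (\sum_i x (f i)) ^+ 2) =
  #|I|%:R * \sum_t p t * x t ^+ 2.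
Proof.
move=> p1 px.
(* Each x (f i) * x (f j) becomes a product over all coordinates, to which [pexp_prod] applies; for
   i = j both factors fall on one coordinate. *)
pose g i j (m : I) (t : T) := (if m == i then x t else 1) * (if m == j then x t else 1).
rewrite (eq_pexp _ (G := fun f => \sum_i \sum_j \prod_m g i j m (f m))); last first.
  move=> f; rewrite expr2 mulr_suml; apply: eq_bigr => i _; rewrite mulr_sumr.
  apply: eq_bigr => j _; rewrite /g big_split/=.
  by rewrite -!big_mkcond/= !big_pred1_eq.
rewrite pexp_sum (eq_bigr (fun=> \sum_t p t * x t ^+ 2)) => [|i _]; last first.
  rewrite pexp_sum (bigD1 i)//= [X in _ + X]big1 ?addr0 => [|j ji].
    rewrite pexp_prod (bigD1 i)//= [X in _ * X]big1 ?mulr1 => [|m mi].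
      by apply: eq_bigr => t _; rewrite /g eqxx expr2.
    by rewrite -[RHS]p1; apply: eq_bigr => t _; rewrite /g (negPf mi) !mulr1.
  rewrite pexp_prod (bigD1 i)//= (_ : \sum_t _ = 0) ?mul0r//.
  by rewrite -[RHS]px; apply: eq_bigr => t _; rewrite /g eqxx eq_sym (negPf ji) mulr1.
by rewrite sumr_const mulr_natl.
Qed.

Section label_moments.
Context {R : realType} {k n : nat} (p : 'I_k -> R).
Hypothesis p0 : forall a, 0 <= p a.
Hypothesis p1 : \sum_a p a = 1.
Local Notation w := (fun _ : 'I_n => p).

Lemma label_count_variance (a : 'I_k) :
  pexp w (fun l => ((label_count l a)%:R - n%:R * p a) ^+ 2) <= n%:R * p a.
Proof.
pose x (b : 'I_k) : R := (b == a)%:R - p a.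
have pa b : p b * (b == a)%:R = if b == a then p a else 0.
  by case: eqP => [->|_]; rewrite ?mulr1 ?mulr0.
have px : \sum_b p b * x b = 0.
  rewrite /x; under eq_bigr do rewrite mulrBr pa.
  by rewrite sumrB -big_mkcond/= big_pred1_eq -mulr_suml p1 mul1r subrr.
rewrite (eq_pexp _ (G := fun l => (\sum_i x (l i)) ^+ 2)); last first.
  move=> l; congr (_ ^+ 2); rewrite /x sumrB sumr_const card_ord mulr_natl; congr (_ - _).
  rewrite /label_count -sum1_card natr_sum big_mkcond/=; apply: eq_bigr => i _.
  by rewrite inE; case: ifP.
rewrite pexp_centered_sum_sqr// card_ord ler_wpM2l//.
have -> : \sum_b p b * x b ^+ 2 = p a - p a ^+ 2.
  rewrite (eq_bigr (fun b => (if b == a then p a else 0) +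
      (- (2 * p a) * (if b == a then p a else 0) + p b * p a ^+ 2))).
    rewrite !big_split/= -mulr_sumr -big_mkcond/= big_pred1_eq -mulr_suml p1; ring.
  by move=> b _; rewrite -pa /x; case: (b == a) => /=; ring.
by rewrite lerBlDr lerDl sqr_ge0.
Qed.

Lemma label_deviation_le : (0 < k)%N -> (0 < n)%N ->
  pexp w (fun l => \sum_a `|(label_count l a)%:R / n%:R - p a|) <=
  Num.sqrt (k%:R / n%:R).
Proof.
move=> k0 n0; have k0' : 0 < k%:R :> R by rewrite ltr0n.
have n0' : 0 < n%:R :> R by rewrite ltr0n.
set t := Num.sqrt _.
have t0 : 0 < t by rewrite sqrtr_gt0 divr_gt0.
have t2 : t ^+ 2 = k%:R / n%:R by rewrite sqr_sqrtr// divr_ge0.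
(* AM-GM with the weight balancing the two sides after summation *)
have amgm l a : `|(label_count l a)%:R / n%:R - p a| <=
    k%:R / (2 * t * n%:R ^+ 2) * ((label_count l a)%:R - n%:R * p a) ^+ 2 + t / (2 * k%:R).
  set N : R := (label_count l a)%:R.
  have -> : N / n%:R - p a = (N - n%:R * p a) / n%:R by field; rewrite gt_eqF.
  rewrite -[(N - _) ^+ 2]real_normK ?num_real// normrM [`|n%:R^-1|]ger0_norm ?invr_ge0//.
  set u := `|_|; rewrite -subr_ge0.
  have -> : k%:R / (2 * t * n%:R ^+ 2) * u ^+ 2 + t / (2 * k%:R) - u / n%:R =
      (k%:R / n%:R * u - t) ^+ 2 / (2 * t * k%:R).
    by field; rewrite !gt_eqF.
  by rewrite divr_ge0 ?sqr_ge0 ?mulr_ge0 ?ltW.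
apply: (@le_trans _ _ (pexp w (fun l => \sum_a (k%:R / (2 * t * n%:R ^+ 2) *
    ((label_count l a)%:R - n%:R * p a) ^+ 2 + t / (2 * k%:R))))).
  by apply: pexp_le => // l; apply: ler_sum => a _; exact: amgm.
rewrite pexp_sum.
apply: (@le_trans _ _ (\sum_a (k%:R / (2 * t * n%:R ^+ 2) * (n%:R * p a) + t / (2 * k%:R)))).
  apply: ler_sum => a _; rewrite pexpD pexpZ pexp_cst// lerD2r ler_wpM2l
      ?label_count_variance//.
  by rewrite divr_ge0// mulr_ge0 ?exprn_ge0// mulr_ge0// ltW.
rewrite big_split/= sumr_const card_ord -[X in _ + X]mulr_natr -!mulr_sumr p1 mulr1.
rewrite le_eqVlt; apply/orP; left; apply/eqP.
have -> : k%:R / (2 * t * n%:R ^+ 2) * n%:R = (k%:R / n%:R) / (2 * t).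
  by field; rewrite !gt_eqF.
by rewrite -t2; field; rewrite !gt_eqF.
Qed.

(** The mean class size n / k is at least 2 n0. A class short of n0 is thus n / (2 k) or more below
    its mean, and its deficit is at most 2 k / n times its squared deviation; the variances then sum
    to the bound. *)
Lemma label_deficit_le (n0 : nat) : (0 < k)%N -> (0 < n)%N -> (2 * k * n0 <= n)%N ->
  (forall a, p a = k%:R^-1) ->
  pexp w (fun l => \sum_a (n0 - #|[set i | l i == a]%SET|)%:R) <= 2 * k%:R.
Proof.
move=> k0 n0' kn pk; have k0' : 0 < k%:R :> R by rewrite ltr0n.
have nr : 0 < n%:R :> R by rewrite ltr0n.
have n0m : 2 * k%:R * n0%:R <= n%:R :> R by rewrite -!natrM ler_nat.
have def (l : {ffun 'I_n -> 'I_k}) a : (n0 - #|[set i | l i == a]%SET|)%:R <=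
    2 * k%:R / n%:R * ((label_count l a)%:R - n%:R * p a) ^+ 2.
  rewrite -/(label_count l a); set N := label_count l a.
  have c0 : 0 <= 2 * k%:R / n%:R :> R by rewrite divr_ge0// mulr_ge0.
  have [le|lt] := leqP n0 N.
    have -> : (n0 - N)%N = 0%N by apply/eqP; rewrite subn_eq0.
    by apply: mulr_ge0 => //; exact: sqr_ge0.
  rewrite natrB 1?ltnW// pk; set m : R := n%:R / k%:R.
  have m0 : 0 < m by rewrite divr_gt0.
  have -> : 2 * k%:R / n%:R = 2 / m by rewrite /m; field; rewrite !gt_eqF.
  have nm : 2 * n0%:R <= m by rewrite /m ler_pdivlMr// mulrAC.
  have Nn : N%:R <= n0%:R :> R by rewrite ler_nat ltnW.
  rewrite mulrAC ler_pdivlMr//.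
  have N0 : 0 <= N%:R :> R by [].
  move: nm Nn N0; rewrite -/m; move: (N%:R) (n0%:R : R) => y z *; nra.
apply: (@le_trans _ _ (pexp w (fun l => \sum_a (2 * k%:R / n%:R *
    ((label_count l a)%:R - n%:R * p a) ^+ 2)))).
  by apply: pexp_le => // l; apply: ler_sum => a _; exact: def.
rewrite pexp_sum; apply: (@le_trans _ _ (\sum_(a < k) 2 * k%:R / n%:R * (n%:R * p a))).
  apply: ler_sum => a _; rewrite pexpZ; apply: ler_wpM2l; last exact: label_count_variance.
  by apply: divr_ge0 => //; apply: mulr_ge0.
by rewrite -!mulr_sumr p1 mulr1 divfK// gt_eqF.
Qed.

End label_moments.

Lemma g_sigma_preimage_bigcap d (T : measurableType d) (Omega : pointedType) (n : nat)
    (X : 'I_n -> Omega -> T) (D : 'I_n -> set T) :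
  (forall i, measurable (D i)) ->
  g_sigma_preimage X (\bigcap_(i in [set: 'I_n]) X i @^-1` D i).
Proof.
move=> mD.
pose Gen := \big[setU/set0]_(i < n) preimage_set_system setT (X i) measurable.
apply: (@fin_bigcap_measurable _ (g_sigma_algebraType Gen)) => [|i _].
  exact: finite_finset.
apply: sub_sigma_algebra; rewrite /Gen -bigcup_seq.
exists i; first by rewrite /= mem_index_enum.
by exists (D i) => //; rewrite setTI.
Qed.

Lemma uniform_prob_unit (R : realType) (B : set R) : measurable B -> B `<=` unit_itv ->
  uniform_prob (@ltr01 R) B = lebesgue_measure B.
Proof.
move=> mB B1; rewrite /uniform_prob.
rewrite (eq_integral (cst 1%E)); first by rewrite integral_cst// mul1e.
move=> x; rewrite inE => /B1; rewrite /unit_itv/= in_itv/= => x01.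
by rewrite /uniform_pdf x01 subr0 invr1.
Qed.

Section reduction.
Context {R : realType} {d : measure_display} {Omega : measurableType d}.
Variables (P : probability Omega R) (k n : nat) (rho : R) (W0 : R -> R -> R).
Variables (phi : R -> 'I_k) (q : 'I_k -> 'I_k -> R).
Variables (xi : 'I_n -> {RV P >-> R}) (A : edge n -> {RV P >-> bool}).
Hypothesis mphi : forall a, measurable (unit_itv `&` phi @^-1` [set a]).
Hypothesis Wq : forall x y, unit_itv x -> unit_itv y -> rho * W0 x y = q (phi x) (phi y).
Hypothesis model : sparse_graphon_model rho W0 xi A.

Definition hidden_labels (w : Omega) : {ffun 'I_n -> 'I_k} := [ffun i => phi (xi i w)].

Let piece (l : {ffun 'I_n -> 'I_k}) (i : 'I_n) : set R := unit_itv `&` phi @^-1` [set l i].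
Let Cl l := \bigcap_(i in [set: 'I_n]) (xi i : Omega -> R) @^-1` piece l i.

Let ClE l : Cl l = [set w | hidden_labels w = l].
Proof.
case: model => xi01 _ _ _.
apply/seteqP; split => w /= H.
  by apply/ffunP => i; rewrite ffunE; case: (H i I).
by move=> i _; split; [exact: xi01|rewrite /= -H ffunE].
Qed.

Let mCl l : measurable (Cl l).
Proof.
apply: fin_bigcap_measurable => [|i _]; first exact: finite_finset.
by rewrite -[X in measurable X]setTI; apply: measurable_funPT => //; exact: mphi.
Qed.

Lemma hidden_labels_law l :
  P [set w | hidden_labels w = l] = (\prod_i class_mass phi (l i))%:E.
Proof.
rewrite -ClE; case: model => xi01 xiU xiI _.
have := xiI [set: 'I_n]%SET (piece l) (fun i => mphi _).
rewrite (_ : [set` _] = [set: 'I_n]); last first.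
  by apply/seteqP; split => i //= _; rewrite inE.
move=> ->; rewrite -prodEFin; rewrite (eq_bigl xpredT) => [|i]; last by rewrite inE.
apply: eq_bigr => i _; have /= := xiU i _ (mphi (l i)).
rewrite /distribution /pushforward => ->.
rewrite (uniform_prob_unit (mphi (l i)) (@subIsetl _ _ _)).
by rewrite class_massE.
Qed.

Let Ob a := [set w | observed A w = a].

Let mOb a : measurable (Ob a).
Proof.
rewrite (_ : Ob a = \bigcap_(e in [set: edge n]) (A e : Omega -> bool) @^-1` [set a e]).
  apply: fin_bigcap_measurable => [|e _]; first exact: finite_finset.
  by rewrite -[X in measurable X]setTI; apply: measurable_funPT.
apply/seteqP; split => w /=.
  by move=> <- e _; rewrite /= ffunE.
by move=> H; apply/ffunP => e; rewrite ffunE; exact: H.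
Qed.

(** The label event is generated by the latent positions and the Bernoulli product is constant on
    it, so the identity defining the conditional probability evaluates directly. *)
Lemma joint_law l a :
  P ([set w | hidden_labels w = l] `&` [set w | observed A w = a]) =
  ((\prod_i class_mass phi (l i)) * \prod_e bern (block_rate q l) e (a e))%:E.
Proof.
case: model => xi01 _ _ /(_ a)[_ cond].
rewrite -cond; last first.
  by rewrite -ClE; apply: (g_sigma_preimage_bigcap (X := fun i => xi i : Omega -> R)) => i;
      exact: mphi.
rewrite (eq_integral (cst (\prod_e bern (block_rate q l) e (a e))%:E)); last first.
  move=> w; rewrite inE /= => lw; congr EFin; apply: eq_bigr => e _.
  rewrite /bern; congr (bernoulli_pmf _ _).
  by rewrite /connection_mx mxE (valP e) Wq// /block_rate -lw !ffunE.
have mL : measurable [set w | hidden_labels w = l] by rewrite -ClE; exact: mCl.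
transitivity ((\prod_e bern (block_rate q l) e (a e))%:E * P [set w | hidden_labels w = l])%E.
  exact: integral_cst.
by rewrite hidden_labels_law -EFinM mulrC.
Qed.

Lemma integral_labels_observations (F : {ffun 'I_n -> 'I_k} -> observations n -> R) :
  (forall l a, 0 <= F l a) ->
  (\int[P]_w (F (hidden_labels w) (observed A w))%:E =
   (pexp (fun _ : 'I_n => class_mass phi)
      (fun l => pexp (bern (block_rate q l)) (F l)))%:E)%E.
Proof.
move=> F0.
pose I := ({ffun 'I_n -> 'I_k} * observations n)%type.
pose H (t : I) := [set w | hidden_labels w = t.1] `&` [set w | observed A w = t.2].
have mH t : measurable (H t).
  by apply: measurableI; [rewrite -ClE; exact: mCl|exact: mOb].
transitivity (\int[P]_w (\sum_(t : I) (F t.1 t.2 * \1_(H t) w)%:E))%E.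
  apply: eq_integral => w _; rewrite (bigD1 (hidden_labels w, observed A w))//=.
  rewrite big1 ?adde0 => [|[l a] ne].
    by rewrite indicE mem_set ?mulr1.
  rewrite indicE memNset ?mulr0// => -[/= lw aw].
  by rewrite lw aw eqxx in ne.
rewrite ge0_integral_sum//; last 2 first.
- move=> t; apply/measurable_EFinP; apply: measurable_funM => //.
- by move=> t w _; rewrite lee_fin mulr_ge0// indicE.
transitivity (\sum_(t : I) ((F t.1 t.2)%:E * P (H t)))%E.
  apply: eq_bigr => t _.
  rewrite (@integralZl_indic _ _ _ _ _ _ (fun=> H t))//; last first.
    by move=> Ft; have := F0 t.1 t.2; rewrite leNgt Ft.
  by rewrite integral_indic// setIT.
rewrite (eq_bigr (fun t : I => ((\prod_i class_mass phi (t.1 i)) *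
    ((\prod_e bern (block_rate q t.1) e (t.2 e)) * F t.1 t.2))%:E)) => [|t _].
  rewrite sumEFin -(pair_bigA _ (fun (l : {ffun 'I_n -> 'I_k}) (a : observations n) =>
      (\prod_i class_mass phi (l i)) *
    ((\prod_e bern (block_rate q l) e (a e)) * F l a)))/=; congr EFin.
  by apply: eq_bigr => l _; rewrite -mulr_sumr.
by rewrite joint_law -EFinM mulrC mulrA.
Qed.

Lemma class_mass_ge0 a : 0 <= class_mass phi a.
Proof. by rewrite fine_ge0. Qed.

Lemma sum_class_mass : \sum_a class_mass phi a = 1.
Proof.
apply: EFin_inj; rewrite -sumEFin.
under eq_bigr do rewrite -class_massE//.
have mu1 : lebesgue_measure (@unit_itv R) = 1%E.
  by rewrite lebesgue_measure_itv/= lte_fin ltr01 -EFinB subr0.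
exact: etrans (esym (@measure_fin_partition _ _ _ lebesgue_measure _ phi unit_itv mphi)) mu1.
Qed.

End reduction.

(** * Risk of the graphon estimators and rates *)

Lemma delta2_ge0 (R : realType) (f f0 : R -> R -> R) : (0 <= delta2 f f0)%E.
Proof.
apply: le_ereal_inf_tmp => _ [tau _ <-]; apply: integral_ge0 => x _.
by rewrite lee_fin sqr_ge0.
Qed.

(* Outside the labels attained on [0,1] the matrix of a step graphon is
   unconstrained, hence the truncation. *)
Definition rate_matrix (R : realType) (k : nat) (rho : R) (Q : 'M[R]_k) (b c : 'I_k) : R :=
  rho * Num.max 0 (Num.min 1 (Q b c)).

Section rate_matrix.
Context {R : realType} (k : nat) (rho : R) (Q : 'M[R]_k).
Hypothesis rho0 : 0 < rho.

Lemma rate_matrix_bounds b c : 0 <= rate_matrix rho Q b c <= rho.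
Proof.
rewrite /rate_matrix; apply/andP; split.
  by apply: mulr_ge0; [exact: ltW|rewrite le_max lexx].
by rewrite ger_pMr// ge_max ler01 ge_min lexx.
Qed.

Lemma rate_matrix_sym b c : Q^T = Q -> rate_matrix rho Q b c = rate_matrix rho Q c b.
Proof. by move=> Qsym; rewrite /rate_matrix -[in LHS]Qsym mxE. Qed.

Lemma rate_matrixE (W0 : R -> R -> R) (phi : R -> 'I_k) x y :
  is_graphon W0 -> step_repr W0 Q phi -> unit_itv x -> unit_itv y ->
  rho * W0 x y = rate_matrix rho Q (phi x) (phi y).
Proof.
move=> [W01 _ _] [_ _ WQ] x1 y1; have := W01 x y x1 y1.
rewrite WQ// /rate_matrix => /andP[h0 h1].
by rewrite min_r// max_r.
Qed.
End rate_matrix.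

Section graphon_risk.
Context {R : realType} {d : measure_display} {Omega : measurableType d}.
Variables (P : probability Omega R) (k n : nat) (rho : R) (W0 : R -> R -> R).
Variables (phi : R -> 'I_k) (Q : 'M[R]_k).
Variables (xi : 'I_n -> {RV P >-> R}) (A : edge n -> {RV P >-> bool}).
Hypothesis n0 : (0 < n)%N.
Hypothesis rho01 : 0 < rho <= 1.
Hypothesis gW : is_graphon W0.
Hypothesis sW : step_repr W0 Q phi.
Hypothesis model : sparse_graphon_model rho W0 xi A.
Local Notation q := (rate_matrix rho Q).
Local Notation label_law := (fun _ : 'I_n => class_mass phi).

(** X bounds the risk for given labels and Y its average. The term n rho^2 comes from the diagonal,
    where That vanishes but q may not; each edge counts twice in the matrix norm. The loss is
    dominated by a function of labels and observations. *)
Lemma graphon_risk_le (That : observations n -> 'M[R]_n) (X : {ffun 'I_n -> 'I_k} -> R) (Y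
    : R) :
  (forall a, exists F, That a = sym0_mx F) ->
  (forall l, pexp (bern (block_rate q l))
    (fun a => \sum_(e : edge n) (block_rate q l e - That a (val e).1 (val e).2) ^+ 2) <= X l) ->
  pexp label_law X <= Y ->
  (\int[P]_w delta2 (empirical_graphon (That (observed A w))) (fun x y => (rho * W0 x y)%R) <=
   (4 * rho ^+ 2 * Num.sqrt (k%:R / n%:R) + 2 / n%:R ^+ 2 * (n%:R * rho ^+ 2 + 2 * Y))%:E)%E.
Proof.
move=> Tsym HX HY.
have /andP[rho0 rho1] := rho01.
have q_rho := rate_matrix_bounds Q rho0.
have qsym b c : q b c = q c b by apply: rate_matrix_sym; case: sW.
have mphi a : measurable (unit_itv `&` phi @^-1` [set a]) by case: sW.
have Wq x y : unit_itv x -> unit_itv y -> rho * W0 x y = q (phi x) (phi y).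
  exact: rate_matrixE.
have k0 : (0 < k)%N by rewrite (leq_ltn_trans _ (ltn_ord (phi 0))).
have nr : 0 < n%:R :> R by rewrite ltr0n.
pose loss (l : {ffun 'I_n -> 'I_k}) a : R :=
  \sum_(e : edge n) (block_rate q l e - That a (val e).1 (val e).2) ^+ 2.
pose dev (l : {ffun 'I_n -> 'I_k}) : R :=
  \sum_b `|(label_count l b)%:R / n%:R - class_mass phi b|.
pose F l a : R := 4 * rho ^+ 2 * dev l + (2 / n%:R ^+ 2 * (n%:R * rho ^+ 2) +
    4 / n%:R ^+ 2 * loss l a).
have loss0 l a : 0 <= loss l a by apply: sumr_ge0 => e _; exact: sqr_ge0.
have c4 : 0 <= 4 / n%:R ^+ 2 :> R by rewrite divr_ge0// exprn_ge0.
have F0 l a : 0 <= F l a.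
  have dev0 : 0 <= dev l by exact: sumr_ge0.
  have c2 : 0 <= 2 / n%:R ^+ 2 :> R by rewrite divr_ge0// exprn_ge0.
  apply: addr_ge0; last apply: addr_ge0.
  - exact: mulr_ge0 (mulr_ge0 (ler0n R 4) (sqr_ge0 rho)) dev0.
  - exact: mulr_ge0 c2 (mulr_ge0 (ler0n R n) (sqr_ge0 rho)).
  - exact: mulr_ge0.
have pt l a : (delta2 (empirical_graphon (That a)) (fun x y => (rho * W0 x y)%R) <=
    (F l a)%:E)%E.
  apply: (le_trans (delta2_empirical_le l mphi n0 _ q_rho Wq)).
  rewrite lee_fin /F lerD2l.
  have [G TG] := Tsym a.
  have T0 i : That a i i = 0 by rewrite TG mxE ltnn.
  have Ts i j : That a i j = That a j i.
    by rewrite TG !mxE; case: (ltngtP i j).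
  rewrite (sum_sym_edge (F := fun i j => (q (l i) (l j) - That a i j) ^+ 2)); last first.
    by move=> i j; rewrite qsym Ts.
  have diag : \sum_i (q (l i) (l i) - That a i i) ^+ 2 <= n%:R * rho ^+ 2.
    rewrite mulr_natl -[n in leRHS]card_ord -sumr_const; apply: ler_sum => i _.
    have /andP[h1 h2] := q_rho (l i) (l i).
    by rewrite T0 subr0 lerXn2r ?nnegrE// ltW.
  have -> : 4 / n%:R ^+ 2 * loss l a = 2 / n%:R ^+ 2 * (2 * loss l a) by ring.
  by rewrite -mulrDr ler_wpM2l ?lerD2r// divr_ge0// exprn_ge0.
apply: (@le_trans _ _ (\int[P]_w (F (hidden_labels phi xi w) (observed A w))%:E)%E).
  apply: ge0_le_integral_any => w _; [exact: delta2_ge0|exact: pt].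
rewrite (integral_labels_observations mphi Wq model F0) lee_fin.
have w0 (i : 'I_n) b : 0 <= class_mass phi b by exact: class_mass_ge0.
have w1 : \sum_b class_mass phi b = 1 by exact: sum_class_mass.
apply: (@le_trans _ _ (pexp label_law (fun l => 4 * rho ^+ 2 * dev l +
    (2 / n%:R ^+ 2 * (n%:R * rho ^+ 2) + 4 / n%:R ^+ 2 * X l)))).
  apply: pexp_le => // l.
  rewrite /F pexpD pexp_cst; last by move=> e; exact: sum_bern.
  rewrite lerD2l pexpD pexp_cst; last by move=> e; exact: sum_bern.
  by rewrite lerD2l pexpZ ler_wpM2l// HX.
rewrite !pexpD !pexpZ pexp_cst//.
have := label_deviation_le (n := n) (class_mass_ge0 phi) w1 k0 n0 => dev_le.
have r2 : 0 <= 4 * rho ^+ 2 by apply: mulr_ge0 => //; exact: sqr_ge0.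
have := ler_wpM2l r2 dev_le; have := ler_wpM2l c4 HY.
have -> : 2 / n%:R ^+ 2 * (n%:R * rho ^+ 2 + 2 * Y) =
  2 / n%:R ^+ 2 * (n%:R * rho ^+ 2) + 4 / n%:R ^+ 2 * Y by ring.
rewrite -/dev; lra.
Qed.

End graphon_risk.

Lemma ln_nat_ge_half (R : realType) (k : nat) : (2 <= k)%N -> 2^-1 <= ln k%:R :> R.
Proof.
move=> k2; rewrite -[leLHS]expRK ler_ln ?posrE ?expR_gt0 ?ltr0n ?(ltnW k2)//.
apply: (@le_trans _ _ 2); last by rewrite ler_nat.
have : expR (2^-1 : R) <= 1 + 2^-1 + 2 * 2^-1 ^+ 2.
  by apply: expR_le_quadratic; rewrite ger0_norm.
lra.
Qed.

Section rates.
Context {R : realType} (k n : nat).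
Hypothesis k2 : (2 <= k)%N.
Hypothesis kn : (k <= n)%N.
Local Notation t := (Num.sqrt (k%:R / n%:R) : R).

Let k0 : 0 < k%:R :> R. Proof. by rewrite ltr0n ltnW. Qed.
Let n0 : 0 < n%:R :> R. Proof. by rewrite ltr0n (leq_trans _ kn)// ltnW. Qed.

Lemma ratio_le_sqrt : k%:R / n%:R <= t.
Proof.
have t0 : 0 < t by rewrite sqrtr_gt0 divr_gt0.
have t2 : t ^+ 2 = k%:R / n%:R by rewrite sqr_sqrtr// divr_ge0// ltW.
have t1 : t <= 1.
  by rewrite -[leRHS]sqrtr1 ler_sqrt// ler_pdivrMr// mul1r ler_nat.
by rewrite -[leLHS]t2 expr2 ger_pMr.
Qed.

(** Shared by both estimators, with c the additive remainder, 0 or 1. Lower-order terms are absorbed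
    through 1 <= k^2 and 1 / n <= k / n <= sqrt (k / n). *)
Lemma risk_rate_le (rho r c : R) : 0 <= r ->
  4 * rho ^+ 2 * t + 2 / n%:R ^+ 2 * (n%:R * rho ^+ 2 +
    2 * (3 * rho ^+ 2 * (n%:R * (2 * k%:R)) + 256 * r * (n%:R * ln k%:R + 7 * k%:R ^+ 2 +
        1) + c)) <=
  1024 * r * (8 * (k%:R ^+ 2 / n%:R ^+ 2) + ln k%:R / n%:R) + 30 * (rho ^+ 2 * t) +
  4 * (c / n%:R ^+ 2).
Proof.
move=> r0; have kt := ratio_le_sqrt.
have n1 : n%:R^-1 <= t.
  by apply: le_trans kt; rewrite ler_peMl ?invr_ge0 ?(ltW n0)// ler1n ltnW.
have kk : (n%:R ^+ 2)^-1 <= k%:R ^+ 2 / n%:R ^+ 2 :> R.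
  by rewrite ler_peMl ?invr_ge0 ?exprn_ge0// exprn_ege1// ler1n ltnW.
have -> : 2 / n%:R ^+ 2 * (n%:R * rho ^+ 2 +
    2 * (3 * rho ^+ 2 * (n%:R * (2 * k%:R)) + 256 * r * (n%:R * ln k%:R + 7 * k%:R ^+ 2 +
        1) + c)) =
  2 * (rho ^+ 2 * n%:R^-1) + 24 * (rho ^+ 2 * (k%:R / n%:R)) +
  1024 * (r * (ln k%:R / n%:R)) + 7 * 1024 * (r * (k%:R ^+ 2 / n%:R ^+ 2)) +
  1024 * (r * (n%:R ^+ 2)^-1) + 4 * (c / n%:R ^+ 2).
  by field; rewrite gt_eqF.
have := ler_wpM2l (sqr_ge0 rho) kt; have := ler_wpM2l (sqr_ge0 rho) n1.
have := ler_wpM2l r0 kk; lra.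
Qed.
End rates.

Theorem corollary3p3 (R : realType) :
  exists C1 C2 : R,
  forall (k n : nat), (2 <= k)%N -> (k <= n)%N ->
  forall (W0 : R -> R -> R) (rho : R),
    step_graphon k W0 -> 0 < rho -> rho <= 1 ->
  forall (d : measure_display) (Omega : measurableType d)
    (P : probability Omega R)
    (xi : 'I_n -> {RV P >-> R}) (A : edge n -> {RV P >-> bool}),
    sparse_graphon_model rho W0 xi A ->
  (k%:R * ln k%:R / n%:R <= rho ->
   balanced_step_graphon k W0 ->
   forall That : observations n -> 'M[R]_n,
   (forall a, is_least_squares k (n %/ (2 * k))%N a (That a)) ->
   (\int[P]_w delta2 (empirical_graphon (That (observed A w)))
                     (fun x y => (rho * W0 x y)%R)
    <= (C1 * (rho * (k%:R ^+ 2 / n%:R ^+ 2 + ln k%:R / n%:R)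
              + rho ^+ 2 * Num.sqrt (k%:R / n%:R)))%:E)%E)
  /\
  (forall r : R, 0 < r -> r <= 1 -> rho <= r ->
   forall That : observations n -> 'M[R]_n,
   (forall a, is_restricted_least_squares k r a (That a)) ->
   (\int[P]_w delta2 (empirical_graphon (That (observed A w)))
                     (fun x y => (rho * W0 x y)%R)
    <= (C2 * (r * (k%:R ^+ 2 / n%:R ^+ 2 + ln k%:R / n%:R)
              + rho ^+ 2 * Num.sqrt (k%:R / n%:R)))%:E)%E).
Proof.
(* Both are the 8 * 1024 of [risk_rate_le]; the first is multiplied by 2048 because r = 2048 rho
   there. *)
exists (16 * (1024 * 1024)), (8 * 1024) => k n k2 kn W0 rho sW rho0 rho1 d Omega P xi A model.
have k0 : 0 < k%:R :> R by rewrite ltr0n ltnW.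
have n0 : (0 < n)%N by rewrite (leq_trans _ kn)// ltnW.
have n0' : 0 < n%:R :> R by rewrite ltr0n.
have rho01 : 0 < rho <= 1 by rewrite rho0.
have lnk := @ln_nat_ge_half R k k2.
have B0 : 0 <= k%:R ^+ 2 / n%:R ^+ 2 :> R by rewrite divr_ge0// exprn_ge0// ltW.
have A0 : 0 <= ln k%:R / n%:R :> R by rewrite divr_ge0 ?(ltW n0')//; lra.
have T0 : 0 <= rho ^+ 2 * Num.sqrt (k%:R / n%:R) by rewrite mulr_ge0 ?sqr_ge0 ?sqrtr_ge0.
have q_rho Q := @rate_matrix_bounds R k rho Q rho0.
split.
- move=> sparse [gW [Q [phi [sr bal]]]] That LS.
  have qsym b c : rate_matrix rho Q b c = rate_matrix rho Q c b by apply: rate_matrix_sym;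
      case: sr.
  have Tsym a : exists F, That a = sym0_mx F by have [Qz _ ->] := LS a; eexists.
  have w0 b : 0 <= class_mass phi b by exact: class_mass_ge0.
  have w1 : \sum_b class_mass phi b = 1 by apply: sum_class_mass; case: sr.
  have mass b : class_mass phi b = k%:R^-1 by rewrite /class_mass bal.
  set m := (n %/ (2 * k))%N in LS.
  have sparse' : k%:R / n%:R <= 2 * rho.
    apply: (@le_trans _ _ (2 * (k%:R * ln k%:R / n%:R))); last by rewrite ler_pM2l.
    by rewrite -mulrA mulrCA ler_pM2l// mulrA ler_peMl ?invr_ge0 ?(ltW n0')//; lra.
  (* If m < 2 then n <= 4 k, so k^2 / n^2 >= 1/16 and rho >= 1/8, and the crude loss is within the
     claimed rate. *)
  have [m2|m2] := ltnP m 2.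
    have n4k : (n <= 4 * k)%N.
      have := ltn_ceil n (_ : 0 < 2 * k)%N; rewrite -/m muln_gt0/= ltnW// => /(_ isT).
      move: m2; rewrite ltnS => m2 /ltnW /leq_trans; apply.
      by rewrite (_ : 4 * k = 2 * (2 * k))%N ?leq_mul2r ?orbT ?ltnS ?m2 ?orbT//; lia.
    apply: (le_trans (graphon_risk_le n0 rho01 gW sr model (X := fun=> n%:R ^+ 2) (Y :=
        n%:R ^+ 2) Tsym _ _)).
    + move=> l; rewrite -[leRHS](pexp_cst (w := bern (block_rate (rate_matrix rho Q) l)));
          last exact: sum_bern.
      apply: pexp_le => [e b|a]; first by apply: bern_ge0; exact: block_rate01 (q_rho Q) rho1 l.
      exact: (@least_squares_loss_le R k n _ rho (q_rho Q) rho1 m l That LS a).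
    + by rewrite pexp_cst.
    rewrite lee_fin.
    have kt := ratio_le_sqrt (R := R) k2 kn.
    have n1 : n%:R^-1 <= Num.sqrt (k%:R / n%:R) :> R.
      by apply: le_trans kt; rewrite ler_peMl ?invr_ge0 ?(ltW n0')// ler1n ltnW.
    have kn4 : 4^-1 <= k%:R / n%:R :> R.
      by rewrite ler_pdivlMr// ler_pdivrMl// -natrM ler_nat.
    have Bk : 16^-1 <= k%:R ^+ 2 / n%:R ^+ 2 :> R.
      by rewrite -expr_div_n; move: kn4; move: (k%:R / n%:R) => x; nra.
    have rB : 128^-1 <= rho * (k%:R ^+ 2 / n%:R ^+ 2).
      have r8 : 8^-1 <= rho by lra.
      move: r8 Bk; move: (k%:R ^+ 2 / n%:R ^+ 2) => x; nra.
    have -> : 2 / n%:R ^+ 2 * (n%:R * rho ^+ 2 + 2 * n%:R ^+ 2) = 2 * (rho ^+ 2 *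
        n%:R^-1) + 4 :> R.
      by field; rewrite gt_eqF.
    have := ler_wpM2l (sqr_ge0 rho) n1; have := mulr_ge0 (ltW rho0) A0; lra.
  (* From k ln k <= rho n <= 4 k rho m follows ln k <= 4 rho m, so r m / 32 = 64 rho m is at least
     16 ln k. *)
  pose r : R := 2 * 1024 * rho.
  have m4k : (n <= 4 * k * m)%N.
    have := ltn_ceil n (_ : 0 < 2 * k)%N; rewrite -/m muln_gt0/= ltnW// => /(_ isT) /ltnW nm.
    apply: (leq_trans nm); rewrite (_ : 4 * k * m = (2 * m) * (2 * k))%N ?leq_mul2r;
        last by lia.
    by apply/orP; right; lia.
  have km : (2 * k * m <= n)%N by rewrite mulnC leq_trunc_div.
  have km' : (k * m <= n)%N by apply: leq_trans km; rewrite leq_mul2r leq_pmull ?orbT.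
  have rm : 13 * ln k%:R <= r * m%:R / 32.
    have h1 : ln k%:R <= 4 * (rho * m%:R).
      have h2 : n%:R <= 4 * k%:R * m%:R :> R by rewrite -!natrM ler_nat.
      have h3 : k%:R * ln k%:R <= rho * n%:R by rewrite -ler_pdivrMr.
      have h4 := ler_wpM2l (ltW rho0) h2.
      rewrite -(ler_pM2l k0); lra.
    rewrite /r; lra.
  pose c : R := 256 * r * (n%:R * ln k%:R + 7 * k%:R ^+ 2 + 1) + 1.
  pose def (l : {ffun 'I_n -> 'I_k}) : R := \sum_b (m - #|[set i | l i == b]%SET|)%:R.
  have := graphon_risk_le n0 rho01 gW sr model
    (X := fun l => 3 * rho ^+ 2 * n%:R * def l + c)
    (Y := 3 * rho ^+ 2 * (n%:R * (2 * k%:R)) + c) Tsym.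
  move=> H; apply: (le_trans (H _ _)) => {H}.
  + move=> l.
    have r4 : 4 * rho <= r by rewrite /r; lra.
    have := @least_squares_estimator_risk R k n _ rho (q_rho Q) qsym rho1 m l That LS r
      k2 m2 km' m4k rho0 r4 rm.
    by rewrite -/(def l) /c -addrA (mulrA (3 * rho ^+ 2)).
  + rewrite pexpD pexpZ pexp_cst// lerD2r mulrA ler_wpM2l//.
      by rewrite mulr_ge0// mulr_ge0// sqr_ge0.
    by apply: label_deficit_le => //; exact: ltnW.
  rewrite lee_fin /c addrA.
  have rge0 : 0 <= r by rewrite /r; lra.
  apply: (le_trans (risk_rate_le k2 kn rho 1 rge0)).
  (* The remainder is charged to rho ln k / n, which is possible because rho n >= k ln k >= 1 and ln
     k >= 1/2. *)
  have h5 : 1 / n%:R ^+ 2 <= 2 * (rho * (ln k%:R / n%:R)).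
    rewrite ler_pdivrMr ?exprn_gt0//.
    have -> : 2 * (rho * (ln k%:R / n%:R)) * n%:R ^+ 2 = 2 * (rho * n%:R) * ln k%:R.
      by field; rewrite gt_eqF.
    have h3 : k%:R * ln k%:R <= rho * n%:R by rewrite -ler_pdivrMr.
    have k2' : 2 <= k%:R :> R by rewrite ler_nat.
    have h6 : 1 <= rho * n%:R.
      by apply: le_trans h3; have := @mulr_ge0 R (k%:R - 2) (ln k%:R - 2^-1);
          rewrite !subr_ge0 => /(_ k2' lnk); lra.
    have := @mulr_ge0 R (rho * n%:R - 1) (ln k%:R - 2^-1).
    by rewrite !subr_ge0 => /(_ h6 lnk); lra.
  have := mulr_ge0 (ltW rho0) A0; have := mulr_ge0 (ltW rho0) B0.
  rewrite /r; lra.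
- move=> r r0 r1 rho_r That LS.
  have [gW [Q [phi sr]]] := sW.
  have Tsym a : exists F, That a = sym0_mx F by have [Qz _ ->] := LS a; eexists.
  have w1 : \sum_b class_mass phi b = 1 by apply: sum_class_mass; case: sr.
  have qsym b c : rate_matrix rho Q b c = rate_matrix rho Q c b by apply: rate_matrix_sym;
      case: sr.
  pose X : R := 3 * rho ^+ 2 * (n%:R * k%:R) + 256 * r * (n%:R * ln k%:R + 7 * k%:R ^+ 2 + 1).
  (* Twice the bias and a zero remainder bring the bound into the form of [risk_rate_le]. *)
  pose Y : R := 3 * rho ^+ 2 * (n%:R * (2 * k%:R)) + 256 * r * (n%:R * ln k%:R +
      7 * k%:R ^+ 2 + 1) + 0.
  apply: (le_trans (graphon_risk_le n0 rho01 gW sr model (X := fun=> X) (Y := Y) Tsym _ _)).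
  + by move=> l; exact: (restricted_least_squares_risk (q_rho Q) qsym rho1 l k2 kn r0 rho_r LS).
  + rewrite pexp_cst// /X /Y addr0 lerD2r ler_wpM2l//.
      by rewrite mulr_ge0// sqr_ge0.
    by rewrite ler_pM2l// ler_peMl ?ler1n// ltW.
  rewrite lee_fin; apply: (le_trans (risk_rate_le k2 kn rho 0 (ltW r0))).
  rewrite mul0r mulr0 addr0.
  have := mulr_ge0 (ltW r0) A0; have := mulr_ge0 (ltW r0) B0; lra.
Qed.
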